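(* Let $p,q\in\mathbb{Z}$ be distinct prime numbers. Then the generalised Baumslag--Solitar group \[G=\langle a,s,t \mid sas^{-1}=a^p,\ tat^{-1}=a^q\rangle\] has undecidable Diophantine problem.
   Context: An equation over a finitely generated group $G$ with variables from a finite set $\mathcal X$ is an element $w\in G*F(\mathcal X)$; a solution is a homomorphism $G*F(\mathcal X)\to G$ restricting to the identity on $G$ and sending $w$ to $1$. A system of equations is a finite collection of equations in the same variables. The Diophantine problem for $G$ asks for an algorithm that, given a finite system of equations over $G$, decides whether it has a solution. *)

(* Defs.v *)
From Stdlib Require Import ZArith List Znumtheory.
Import ListNotations.

(* A letter is (x, b): b = false means x, b = true means x^{-1}. *)
Definition letter (X : Type) := (X * bool)%type.
Definition word (X : Type) := list (letter X).

Definition linv {X} (l : letter X) : letter X := (fst l, negb (snd l)).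
Definition winv {X} (w : word X) : word X := rev (map linv w).

(* Equality in the group < X | R >: the smallest equivalence relation on words
   that allows deleting (hence inserting) a trivial pair x x^{-1} or a relator
   anywhere inside a word. Two words are equal in the presented group iff
   they are related. *)
Inductive geq {X : Type} (R : list (word X)) : word X -> word X -> Prop :=
| geq_refl w : geq R w w
| geq_sym u v : geq R u v -> geq R v u
| geq_trans u v w : geq R u v -> geq R v w -> geq R u w
| geq_free u v l : geq R (u ++ l :: linv l :: v) (u ++ v)
| geq_rel u r v : In r R -> geq R (u ++ r ++ v) (u ++ v).

Inductive gen := Ga | Gs | Gt.

Definition apow (k : Z) : word gen :=
  if (0 <=? k)%Z then repeat (Ga, false) (Z.to_nat k)
  else repeat (Ga, true) (Z.to_nat (- k)).

Definition bs_relators (p q : Z) : list (word gen) :=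
  [ [(Gs, false); (Ga, false); (Gs, true)] ++ apow (- p) ;
    [(Gt, false); (Ga, false); (Gt, true)] ++ apow (- q) ].

(* Symbols of G * F(X): constants from the generators of G, variables nat. *)
Inductive sym := Const (g : gen) | Var (n : nat).

Definition equation := word sym.
Definition system := list equation.

(* A solution is a homomorphism G * F(X) -> G which is the identity on G;
   it is determined by an arbitrary assignment of (words representing)
   elements of G to the variables. *)
Definition subst_letter (sigma : nat -> word gen) (l : letter sym) : word gen :=
  match l with
  | (Const g, b) => [(g, b)]
  | (Var n, false) => sigma n
  | (Var n, true) => winv (sigma n)
  end.

Definition subst (sigma : nat -> word gen) (w : equation) : word gen :=
  flat_map (subst_letter sigma) w.

Definition has_solution (R : list (word gen)) (S : system) : Prop :=
  exists sigma : nat -> word gen, Forall (fun w => geq R (subst sigma w) []) S.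

(* ---------- Goedel numbering of systems (a bijection system <-> nat) ---------- *)
Local Open Scope nat_scope.
Definition cpair (x y : nat) : nat := (x + y) * (x + y + 1) / 2 + y.

Definition enc_sym (s : sym) : nat :=
  match s with
  | Const Ga => 0 | Const Gs => 1 | Const Gt => 2
  | Var n => n + 3
  end.

Definition enc_letter (l : letter sym) : nat :=
  2 * enc_sym (fst l) + (if snd l then 1 else 0).

Fixpoint enc_list {A} (e : A -> nat) (l : list A) : nat :=
  match l with
  | [] => 0
  | x :: l' => S (cpair (e x) (enc_list e l'))
  end.

Definition enc_system (S : system) : nat := enc_list (enc_list enc_letter) S.

Open Scope nat_scope.
Inductive mu : Type :=
| MZero
| MSucc
| MProj (i : nat)
| MComp (f : mu) (gs : list mu)
| MPrec (f g : mu)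
| MMin (f : mu).

Inductive ev : mu -> list nat -> nat -> Prop :=
| ev_zero v : ev MZero v 0
| ev_succ x v : ev MSucc (x :: v) (S x)
| ev_proj i v : ev (MProj i) v (nth i v 0%nat)
| ev_comp f gs v ws y :
    Forall2 (fun g w => ev g v w) gs ws -> ev f ws y -> ev (MComp f gs) v y
| ev_prec0 f g v y : ev f v y -> ev (MPrec f g) (0 :: v) y
| ev_precS f g n v z y :
    ev (MPrec f g) (n :: v) z -> ev g (n :: z :: v) y ->
    ev (MPrec f g) (S n :: v) y
| ev_min f v n :
    ev f (n :: v) 0 ->
    (forall m, m < n -> exists k, ev f (m :: v) (S k)) ->
    ev (MMin f) v n.

Definition mu_decidable (P : nat -> Prop) : Prop :=
  exists f : mu, forall n, (P n -> ev f [n] 1) /\ (~ P n -> ev f [n] 0).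

Definition diophantine_decidable (R : list (word gen)) : Prop :=
  mu_decidable (fun n => exists S : system, enc_system S = n /\ has_solution R S).

(* Main.v *)
Require Import Defs.
From Stdlib Require Import ZArith Znumtheory Zpow_facts List Lia Reals Lra.
From Stdlib Require Import Setoid Morphisms FunctionalExtensionality.
From mathcomp Require all_boot.
Import ListNotations.
Open Scope nat_scope.

(* Interpret the integer [n] as an element with exponent sums [(n, n)] in [s] and [t].
   Three facts make arithmetic with exponentiation existentially definable in [G].
   - Killing [a] and mapping [s], [t] to the generators of the Heisenberg group shows
     that commuting elements have proportional exponent vectors, which defines
     multiplication by means of the centralizer of [x t].
   - In the affine group of the line ([a] a translation, [s] and [t] the homotheties of
     ratio [p] and [q]) only elements of ratio 1 commute with a conjugate of [a]; since
     [p] and [q] are distinct primes this says that both exponent sums vanish, and every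
     element with vanishing exponent sums does commute with a conjugate of [a].
   - Conjugating powers of [a] by [(s t)^n] multiplies exponents by [(p q)^n], and
     [(b^(jk) - 1) / (b^j - 1)] is congruent to [k] modulo [b^j - 1]; this defines
     [k = b^i] for [b = p q], hence also the natural numbers.
   Exponential Diophantine sets being closed under one bounded universal quantifier over
   a polynomial equation (Davis, Putnam, Robinson), the relation [ev f [n] y] is
   existentially definable: it says that a stack of goals can be resolved, and each
   resolution step is polynomial.  A decision procedure [f] then gives a system [T] such
   that [T], with the value of one variable fixed to the code of [T], is solvable if and
   only if [f] says that it is not. *)

(** * Number theory *)

Inductive expr := EVar (i : nat) | ECst (c : nat) | EAdd (e f : expr) | EMul (e f : expr).

Fixpoint eval (e : expr) (r : nat -> nat) : nat :=
  match e with
  | EVar i => r i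
  | ECst c => c
  | EAdd e f => eval e r + eval f r
  | EMul e f => eval e r * eval f r
  end.

Definition scons {A} (x : A) (r : nat -> A) (i : nat) : A :=
  match i with 0 => x | S i => r i end.

(** Models a block of [m] existential quantifiers, [w] supplying the witnesses. *)
Definition env_app {A} (m : nat) (w r : nat -> A) (i : nat) : A :=
  if Nat.ltb i m then w i else r (i - m).

Module NumberTheory.
Import all_boot.

Lemma expn_pow m n : m ^ n = Nat.pow m n.
Proof. by elim: n => //= n IH; rewrite expnS IH. Qed.

(** * Chinese remainders and prime divisors *)

Lemma crt n (m x : nat -> nat) :
  (forall i j, i < j < n -> coprime (m i) (m j)) ->
  exists a, forall i, i < n -> a = x i %[mod m i].
Proof.
elim: n => [|n IH] H; first by exists 0.
have [|a Ha] := IH.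
  by move=> i j /andP[ij jn]; apply: H; rewrite ij /= ltnS ltnW.
have cop : coprime (\prod_(i < n) m i) (m n).
  elim/big_rec: _ => [|i y _ IHy]; first by rewrite coprime1n.
  by rewrite coprimeMl IHy andbT; apply: H; rewrite ltn_ord ltnS leqnn.
exists (chinese (\prod_(i < n) m i) (m n) a (x n)) => i.
rewrite ltnS leq_eqVlt => /orP[/eqP->|lin]; first by rewrite chinese_modr.
rewrite -(Ha i lin) -(@modn_dvdm (\prod_(i < n) m i) _ (m i)) ?chinese_modl //.
  by rewrite modn_dvdm // (bigD1 (Ordinal lin)) //= dvdn_mulr.
by rewrite (bigD1 (Ordinal lin)) //= dvdn_mulr.
Qed.

Lemma dvdn_coprime_prod n (m : nat -> nat) X :
  (forall i j, i < j < n -> coprime (m i) (m j)) ->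
  (forall i, i < n -> m i %| X) -> \prod_(i < n) m i %| X.
Proof.
elim: n => [|n IH] H D; first by rewrite big_ord0 dvd1n.
rewrite big_ord_recr /= Gauss_dvd; last first.
  elim/big_rec: _ => [|i y _ IHy]; first by rewrite coprime1n.
  by rewrite coprimeMl IHy andbT; apply: H; rewrite ltn_ord ltnS leqnn.
rewrite D // andbT IH // => [i j /andP[ij jn]|i lin].
  by apply: H; rewrite ij /= ltnS ltnW.
by apply: D; rewrite ltnS ltnW.
Qed.

Lemma eqn_mod_coprime_prod n (m : nat -> nat) x y :
  (forall i j, i < j < n -> coprime (m i) (m j)) ->
  (forall i, i < n -> x = y %[mod m i]) -> x = y %[mod \prod_(i < n) m i].
Proof.
move=> cop; wlog le : x y / x <= y => [H|] E.
  case: (leqP x y) => [/H|/ltnW/H] e; first exact: e.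
  by apply/esym/e => i /E ->.
apply/esym/eqP; rewrite eqn_mod_dvd //; apply: dvdn_coprime_prod => // i lin.
by rewrite -eqn_mod_dvd //; apply/eqP/esym/E.
Qed.

Lemma prime_dvd_fact P n : prime P -> P %| n`! -> P <= n.
Proof.
move=> pP; elim: n => [|n IH]; first by rewrite dvdn1 => /eqP E; rewrite E in pP.
rewrite factS Euclid_dvdM // => /orP[|/IH/leqW //]; exact: dvdn_leq.
Qed.

(** The falling factorial [a (a - 1) ... (a - n + 1)] is a multiple of the binomial coefficient, so
    a prime dividing the latter divides one factor [a - j]. In this way a divisibility can say that
    a residue is small. *)
Lemma prime_dvd_binomial P a n : prime P -> P %| 'C(a, n) ->
  exists2 j, j < n & a = j %[mod P].
Proof.
move=> pP d; have {d} : P %| a ^_ n by rewrite -bin_ffact dvdn_mulr.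
elim: n => [|n IH]; first by rewrite dvdn1 => /eqP E; rewrite E in pP.
rewrite ffactnSr Euclid_dvdM // => /orP[/IH[j jn E]|d].
  by exists j => //; rewrite ltnS ltnW.
(* With truncated subtraction the factor also vanishes for [a < n]; then [a] itself is the small
   residue. *)
case: (leqP n a) => [na|/ltnW an]; last by exists a.
by exists n => //; apply/eqP; rewrite eqn_mod_dvd.
Qed.

(** By the binomial theorem the coefficients are the digits of [(b + 1)^n] in base [b]: all are at
    most [2^n], so no carry occurs. [A] and [B] hold the digits above and below position [k]. *)
Lemma binomial_digit b n k c : 2 ^ n < b ->
  c = 'C(n, k) <->
  exists A B, [/\ b.+1 ^ n = A * b ^ k.+1 + c * b ^ k + B, c < b & B < b ^ k].
Proof.
move=> hb.
have b0 : 0 < b by apply: leq_trans hb.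
have binlt i : 'C(n, i) < b.
  apply: leq_ltn_trans hb.
  have -> : 2 ^ n = \sum_(j < n.+1) 'C(n, j).
    rewrite -[2]/(1 + 1) expnDn; apply: eq_bigr => j _.
    by rewrite !exp1n !muln1.
  case: (leqP i n) => [lin|ltn]; last by rewrite bin_small.
  by rewrite (bigD1 (Ordinal (lin : i < n.+1))) //= leq_addr.
have low j : \sum_(0 <= i < j) 'C(n, i) * b ^ i < b ^ j.
  elim: j => [|j IH]; first by rewrite big_geq.
  rewrite big_nat_recr //= expnS.
  apply: (@leq_trans (b ^ j + 'C(n, j) * b ^ j)); first by rewrite ltn_add2r.
  by rewrite -mulSn leq_mul2r binlt orbT.
(* Vanishing terms are added so that the sum reaches past position [k] even when [k] exceeds [n]. *)
have sumE : b.+1 ^ n = \sum_(0 <= i < (n + k).+2) 'C(n, i) * b ^ i.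
  rewrite (@big_cat_nat _ _ _ n.+1) //=; last by rewrite ltnS -addnS leq_addr.
  rewrite [X in _ + X]big1_seq ?addn0.
    rewrite -addn1 addnC expnDn big_mkord; apply: eq_bigr => i _.
    by rewrite exp1n mul1n.
  by move=> i /=; rewrite mem_index_iota => /andP[ni _]; rewrite bin_small.
have [A EA] : exists A, b.+1 ^ n
    = A * b ^ k.+1 + 'C(n, k) * b ^ k + \sum_(0 <= i < k) 'C(n, i) * b ^ i.
  rewrite sumE (@big_cat_nat _ _ _ k.+1) //=; last by rewrite ltnS leqW // leq_addl.
  have /dvdnP[A ->] : b ^ k.+1 %| \sum_(k.+1 <= i < (n + k).+2) 'C(n, i) * b ^ i.
    rewrite big_seq; apply: dvdn_sum => i; rewrite mem_index_iota => /andP[ki _].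
    by apply: dvdn_mull; apply: dvdn_exp2l.
  exists A; rewrite big_nat_recr //= [LHS]addnC [X in _ + X = _]addnC.
  by rewrite addnA.
split => [->|[A' [B [E cb Bb]]]].
  by exists A, (\sum_(0 <= i < k) 'C(n, i) * b ^ i).
have bk : 0 < b ^ k by rewrite expn_gt0 b0.
have digit a' c' B' : c' < b -> B' < b ^ k ->
    (a' * b ^ k.+1 + c' * b ^ k + B') %/ b ^ k %% b = c'.
  move=> h1 h2; rewrite expnS mulnA -mulnDl divnMDl // divn_small // addn0.
  by rewrite modnMDl modn_small.
by rewrite -(digit A' c B) // -E EA digit.
Qed.

Lemma ffact_le_expn r n : r ^_ n <= r ^ n.
Proof.
elim: n => // n IH; rewrite ffactnSr expnS mulnC.
by apply: leq_mul => //; rewrite leq_subr.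
Qed.

(** Each of the [n] factors of the falling factorial falls short of [r] by at most [n], and
    correcting one of them costs at most [n * r ^ n.-1]. *)
Lemma ffact_lower r n : n <= r -> r ^ n <= r ^_ n + n * n * r ^ n.-1.
Proof.
elim: n => [|n IH] nr //.
have {}IH := IH (ltnW nr).
rewrite expnS ffactnSr /=.
have : r * r ^ n <= r * (r ^_ n) + n * n * r ^ n.
  case: n IH nr => [|n] IH nr; first by rewrite ffactn0 expn0 muln1 leq_addr.
  rewrite -[X in X <= _]/(r * r ^ n.+1); apply: (leq_trans (leq_mul (leqnn r) IH)).
  by rewrite mulnDr leq_add2l /= [r ^ n.+1]expnS mulnCA.
have le1 := ffact_le_expn r n.
move/leq_trans; apply.
have -> : r * r ^_ n = r ^_ n * (r - n) + n * r ^_ n.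
  by rewrite [n * _]mulnC -mulnDr subnK 1?mulnC // ltnW.
rewrite -addnA leq_add2l.
apply: (@leq_trans (n * r ^ n + n * n * r ^ n)).
  by rewrite leq_add2r leq_mul2l le1 orbT.
rewrite -mulnDl leq_mul2r; apply/orP; right.
by rewrite -mulSn leq_mul.
Qed.

(** The quotient of [r ^ n] by the binomial coefficient is [n!] times [r ^ n / r ^_ n], a ratio that
    tends to 1 from above, so for large [r] the integer part of the quotient is [n!]. The bound on
    [r] uses [n ^ n] in place of [n!] to stay free of factorials. *)
Lemma factorial_quotient r n f : (n ^ n).+1 * (n * n) < r ->
  f = n`! <-> f * 'C(r, n) <= r ^ n < f.+1 * 'C(r, n).
Proof.
move=> hr.
have nr : n <= r.
  apply: leq_trans (ltnW hr); apply: (@leq_trans (n * n)); last exact: leq_pmull.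
  by case: (n) => // m; apply: leq_pmulr.
have low := ffact_lower _ _ nr.
have c0 : 0 < 'C(r, n) by rewrite bin_gt0.
have E : n`! * 'C(r, n) = r ^_ n by rewrite mulnC bin_ffact.
have le1 := ffact_le_expn r n.
have fle : n`! <= n ^ n by rewrite -ffactnn ffact_le_expn.
have key : r ^ n < n`!.+1 * 'C(r, n).
  have f0 : 0 < n`! by apply: fact_gt0.
  rewrite -(ltn_pmul2l f0) mulnCA E mulSn.
  case: n => [|n] in hr nr low c0 E le1 fle f0 *; first by rewrite ffactn0 expn0.
  move: low; set e := (r ^ n.+1.-1); set P := r ^ n.+1; set F := r ^_ n.+1 => low.
  have EP : P = r * e by rewrite /P expnS.
  have e0 : 0 < e by rewrite /e expn_gt0 (leq_trans _ nr).
  have h : n.+1`!.+1 * (n.+1 * n.+1 * e) < P.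
    rewrite EP mulnA ltn_pmul2r //; apply: leq_ltn_trans hr.
    by rewrite leq_mul2r ltnS fle orbT.
  rewrite mulSn in h.
  have h2 : n.+1`! * P <= n.+1`! * F + n.+1`! * (n.+1 * n.+1 * e).
    by rewrite -mulnDr leq_mul2l low orbT.
  apply: (leq_ltn_trans h2); rewrite addnC ltn_add2r.
  rewrite -(ltn_add2l (n.+1 * n.+1 * e)); apply: (leq_trans h).
  by rewrite addnC.
have E1 : n`! * 'C(r, n) <= r ^ n by rewrite E.
split=> [->|/andP[h1 h2]]; first by rewrite E1 key.
apply/eqP; rewrite eqn_leq -[f <= _]ltnS -[n`! <= f]ltnS.
rewrite -(@ltn_pmul2r 'C(r, n)) // -[_ < f.+1](@ltn_pmul2r 'C(r, n)) //.
by rewrite (leq_ltn_trans h1 key) (leq_ltn_trans E1 h2).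
Qed.

Lemma eval_mod d e r r' :
  (forall i, r i = r' i %[mod d]) -> eval e r = eval e r' %[mod d].
Proof.
move=> H; elim: e => [i|c|e IHe f IHf|e IHe f IHf] //=.
  by rewrite -modnDm IHe IHf modnDm.
by rewrite -modnMm IHe IHf modnMm.
Qed.

Lemma eval_mono e r r' : (forall i, r i <= r' i) -> eval e r <= eval e r'.
Proof.
move=> H; elim: e => [i|c|e IHe f IHf|e IHe f IHf] //=; first exact: leq_add.
exact: leq_mul.
Qed.

(* The moduli [m k] are pairwise coprime, have only prime factors above [Q], satisfy
   [N = k] modulo [m k], and multiply to ['C(N, y)]. *)
Section Moduli.
Variables (Q N y : nat).
Hypotheses (Q2 : 2 < Q) (yQ : y <= Q) (dvdN : Q`! * Q`! %| N.+1).

Let m k := (N.+1 %/ k.+1).-1.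

Lemma modulus_eq k : k < y -> N.+1 = k.+1 * (m k).+1.
Proof.
move=> ky; have d : k.+1 %| N.+1.
  apply: dvdn_trans dvdN; apply: dvdn_mulr; apply: dvdn_fact.
  by rewrite ltn0Sn (leq_trans ky).
rewrite /m prednK; first by rewrite mulnC divnK.
by rewrite divn_gt0 // dvdn_leq.
Qed.

(** The factorial is squared in [dvdN] for this: one copy absorbs the divisor [k.+1] and the other
    survives. *)
Lemma modulus_dvd k : k < y -> Q`! %| (m k).+1.
Proof.
move=> ky; rewrite -(@dvdn_pmul2l k.+1) // -modulus_eq //.
apply: dvdn_trans dvdN; rewrite dvdn_pmul2r ?fact_gt0 //; apply: dvdn_fact.
by rewrite ltn0Sn (leq_trans ky).
Qed.

(** A prime up to [Q] divides [Q!], hence [(m k).+1], and so not [m k]. *)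
Lemma modulus_prime k P : k < y -> prime P -> P %| m k -> Q < P.
Proof.
move=> ky pP Pm; rewrite ltnNge; apply/negP => PQ.
have : P %| (m k).+1.
  by apply: dvdn_trans (modulus_dvd k ky); apply: dvdn_fact; rewrite prime_gt0.
by rewrite -addn1 dvdn_addr // dvdn1 => /eqP P1; rewrite P1 in pP.
Qed.

Lemma modulus_gt1 k : k < y -> 1 < m k.
Proof.
move=> ky; rewrite -ltnS; apply: leq_trans (dvdn_leq _ (modulus_dvd k ky)) => //.
by apply: (leq_trans Q2); apply: fact_geq.
Qed.

Lemma modulus_residue k : k < y -> N = k %[mod m k].
Proof.
move=> ky; have := modulus_eq k ky; rewrite mulnS addSn => -[->].
by rewrite addnC modnMDl.
Qed.

(** A common prime factor [P] gives [i = N = j] modulo [P], whereas [i] and [j] are below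
    [y <= Q < P]. *)
Lemma modulus_coprime i j : i < j < y -> coprime (m i) (m j).
Proof.
move=> /andP[ij jy]; have iy := ltn_trans ij jy.
rewrite /coprime; case: (ltngtP (gcdn (m i) (m j)) 1) => // [|h].
  by rewrite ltnS leqNgt gcdn_gt0 (ltnW (modulus_gt1 i iy)).
pose P := pdiv (gcdn (m i) (m j)).
have pP : prime P by apply: pdiv_prime.
have Pi : P %| m i by apply: dvdn_trans (pdiv_dvd _) (dvdn_gcdl _ _).
have Pj : P %| m j by apply: dvdn_trans (pdiv_dvd _) (dvdn_gcdr _ _).
have QP := modulus_prime i P iy pP Pi.
have lt k : k < y -> k < P by move=> ky; apply: leq_trans (leq_trans ky yQ) (ltnW QP).
have : i = j %[mod P].
  rewrite -(modn_dvdm i Pi) -(modulus_residue i iy) (modn_dvdm _ Pi).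
  by rewrite -(modn_dvdm _ Pj) (modulus_residue j jy) (modn_dvdm _ Pj).
by rewrite !modn_small ?lt // => E; rewrite E ltnn in ij.
Qed.

(** Factor by factor, [m k] is [(N - k) / (k + 1)]. *)
Lemma modulus_prod : 'C(N, y) = \prod_(k < y) m k.
Proof.
apply/eqP; rewrite -(@eqn_pmul2r y`!) ?fact_gt0 // bin_ffact; apply/eqP.
rewrite ffact_prod fact_prod big_add1 /= big_mkord -big_split /=.
apply: eq_bigr => k _; have := modulus_eq k (ltn_ord k).
by rewrite mulnS addSn => -[->]; rewrite addKn mulnC.
Qed.
End Moduli.

(** * Elimination of a bounded quantifier *)

Lemma max_bound (f : nat -> nat) n : exists u, forall i, i < n -> f i <= u.
Proof.
exists (\max_(i < n) f i) => i lin.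
exact: (@leq_bigmax _ (fun i : 'I_n => f i) (Ordinal lin)).
Qed.

Lemma max_bound2 (f : nat -> nat -> nat) n m :
  exists u, forall i j, i < n -> j < m -> f i j <= u.
Proof.
elim: n => [|n [u hu]]; first by exists 0.
have [v hv] := max_bound (f n) m; exists (maxn u v) => i j.
rewrite ltnS leq_eqVlt leq_max => /orP[/eqP->|lin] ljm; first by rewrite hv // orbT.
by rewrite hu.
Qed.

(** The Davis-Putnam-Robinson argument. [u] bounds all witnesses, [N] stands for every [k < y] at
    once because [N = k] modulo the [k]-th modulus, and [a i] packs the [i]-th witnesses of all [k]
    by Chinese remainders. Conversely, modulo a prime factor of the [k]-th modulus each [a i]
    becomes a residue at most [u]; both sides are then below [Q], hence below the prime, and the
    congruence is an equality. *)
Lemma bounded_forall (l r : expr) m y (p : nat -> nat) :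
  (forall k, k < y -> exists w,
     eval l (env_app m w (scons k p)) = eval r (env_app m w (scons k p))) <->
  exists u Q N a,
    [/\ 2 < Q, y <= Q, u < Q,
        eval l (env_app m (fun=> u) (scons y p)) < Q &
        eval r (env_app m (fun=> u) (scons y p)) < Q] /\
    [/\ Q`! * Q`! %| N.+1,
        forall i, i < m -> 'C(N, y) %| 'C(a i, u.+1) &
        eval l (env_app m a (scons N p)) = eval r (env_app m a (scons N p))
          %[mod 'C(N, y)]].
Proof.
have appE w q i : @env_app nat m w q i = if i < m then w i else q (i - m).
  by rewrite /env_app; case: ltnP => /leP; case: (Nat.ltb_spec i m) => //; lia.
split=> [H|[u [Q [N [a [[Q2 yQ uQ lQ rQ] [dN da E]]]]]] k ky].
  have [w Hw] : exists w : nat -> nat -> nat, forall k, k < y ->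
      eval l (env_app m (w k) (scons k p)) = eval r (env_app m (w k) (scons k p)).
    elim: y H => [|y IH] H; first by exists (fun _ _ => 0).
    have [|w Hw] := IH; first by move=> k ky; apply: H; rewrite ltnS ltnW.
    have [v Hv] := H y (ltnSn y).
    exists (fun k => if k == y then v else w k) => k.
    rewrite ltnS leq_eqVlt; case: eqP => [->|_] //=; exact: Hw.
  have [u hu] := max_bound2 w y m.
  pose bl := eval l (env_app m (fun=> u) (scons y p)).
  pose br := eval r (env_app m (fun=> u) (scons y p)).
  pose Q := 3 + y + u + bl + br.
  have Q2 : 2 < Q by apply/leP; rewrite /Q -!plusE; lia.
  have yQ : y <= Q by apply/leP; rewrite /Q -!plusE; lia.
  have uQ : u < Q by apply/leP; rewrite /Q -!plusE; lia.
  have lQ : bl < Q by apply/leP; rewrite /Q -!plusE; lia.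
  have rQ : br < Q by apply/leP; rewrite /Q -!plusE; lia.
  pose N := (Q`! * Q`!).-1.
  have EN : N.+1 = Q`! * Q`! by rewrite prednK // muln_gt0 fact_gt0.
  have dN : Q`! * Q`! %| N.+1 by rewrite EN.
  pose mk k := (N.+1 %/ k.+1).-1.
  have cop := modulus_coprime Q N y Q2 yQ dN.
  have [a Ha] : exists a : nat -> nat, forall i, i < m ->
      forall k, k < y -> a i = w k i %[mod mk k].
    elim: (m) => [|n [a IH]]; first by exists (fun=> 0).
    have [v Hv] := crt y mk (fun k => w k n) cop.
    exists (fun i => if i == n then v else a i) => i.
    by rewrite ltnS leq_eqVlt; case: eqP => [->|_] //=; apply: IH.
  exists u, Q, N, a; split; split=> //.
    move=> i lim; rewrite (modulus_prod Q N y yQ dN).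
    apply: (dvdn_coprime_prod y mk _ cop) => k ky.
    (* The modulus is prime to the factorial of [u.+1], so it divides the binomial coefficient as
       soon as it divides the falling factorial, which has the factor [a i - w k i]. *)
    have c : coprime (mk k) u.+1`!.
      rewrite coprime_sym; apply/negPn/negP => nc.
      have g1 : 1 < gcdn u.+1`! (mk k).
        rewrite ltn_neqAle eq_sym gcdn_gt0 fact_gt0 andbT.
        by move: nc; rewrite /coprime.
      have pP := pdiv_prime g1; set P := pdiv _ in pP.
      have QP : Q < P.
        apply: (modulus_prime Q N y yQ dN k) => //.
        exact: dvdn_trans (pdiv_dvd _) (dvdn_gcdr _ _).
      have : P %| u.+1`! by apply: dvdn_trans (pdiv_dvd _) (dvdn_gcdl _ _).
      move/(prime_dvd_fact _ _ pP) => Pu.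
      by move: (leq_trans QP Pu); rewrite ltnS leqNgt uQ.
    rewrite -(Gauss_dvdl _ c) bin_ffact ffact_prod.
    have wu : w k i < u.+1 by rewrite ltnS hu.
    rewrite (bigD1 (Ordinal wu)) //=; apply: dvdn_mulr.
    have := Ha i lim k ky => /eqP; case: (leqP (w k i) (a i)) => [le|lt].
      by rewrite eqn_mod_dvd.
    by rewrite (eqP (ltnW lt : a i - w k i == 0)) dvdn0.
  rewrite (modulus_prod Q N y yQ dN); apply: (eqn_mod_coprime_prod y mk _ _ cop) => k ky.
  have res e : eval e (env_app m a (scons N p)) = eval e (env_app m (w k) (scons k p))
      %[mod mk k].
    apply: eval_mod => i; rewrite !appE; case: ifP => [lim|_]; first exact: Ha.
    case: (i - m) => //=; exact: (modulus_residue Q N y yQ dN).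
  by rewrite !res Hw.
pose mk := (N.+1 %/ k.+1).-1.
have g1 := modulus_gt1 Q N y Q2 yQ dN k ky.
have pP := pdiv_prime g1; set P := pdiv _ in pP.
have Pm : P %| mk by apply: pdiv_dvd.
have QP := modulus_prime Q N y yQ dN k P ky pP Pm.
have PM : P %| 'C(N, y).
  by rewrite (modulus_prod Q N y yQ dN) (bigD1 (Ordinal ky)) //= dvdn_mulr.
have [w Hw] : exists w : nat -> nat, forall i, i < m -> w i <= u /\ a i = w i %[mod P].
  elim: (m) da => [|n IH] da; first by exists (fun=> 0).
  have [|w Hw] := IH; first by move=> i lin; apply: da; rewrite ltnS ltnW.
  have [j ju Ej] := prime_dvd_binomial P (a n) u.+1 pP (dvdn_trans PM (da n (ltnSn n))).
  exists (fun i => if i == n then j else w i) => i.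
  by rewrite ltnS leq_eqVlt; case: eqP => [->|_] //= /Hw.
exists w.
have res e : eval e (env_app m a (scons N p)) = eval e (env_app m w (scons k p))
    %[mod P].
  apply: eval_mod => i; rewrite !appE; case: ifP => [lim|_]; first by case: (Hw i lim).
  case: (i - m) => //=; rewrite -(modn_dvdm _ Pm).
  by rewrite (modulus_residue Q N y yQ dN k ky) (modn_dvdm _ Pm).
have small e : eval e (env_app m (fun=> u) (scons y p)) < Q ->
    eval e (env_app m w (scons k p)) < P.
  move=> h; apply: leq_ltn_trans (ltn_trans h QP); apply: eval_mono => i.
  rewrite !appE; case: ifP => [lim|_]; first by case: (Hw i lim).
  by case: (i - m) => //=; apply: ltnW.
have : eval l (env_app m w (scons k p)) = eval r (env_app m w (scons k p)) %[mod P].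
  by rewrite -!res -(modn_dvdm _ PM) E (modn_dvdm _ PM).
by rewrite !modn_small ?small.
Qed.

Lemma godel_beta n (x : nat -> nat) : exists c d, forall k, (k < n)%coq_nat ->
  exists q, (c = q * (1 + (k + 1) * d) + x k /\ x k <= (k + 1) * d)%coq_nat.
Proof.
have [u hu] := max_bound x n.
(* A multiple of all index differences, which makes the moduli pairwise coprime, and at least as
   large as every [x k]. *)
pose d := (n + u)`!.
have d0 : 0 < d by apply: fact_gt0.
pose m k := (k.+1 * d).+1.
have cop i j : i < j < n -> coprime (m i) (m j).
  move=> /andP[ij jn]; apply/negPn/negP => nc.
  have g1 : 1 < gcdn (m i) (m j) by rewrite ltn_neqAle eq_sym gcdn_gt0 andbT.
  have pP := pdiv_prime g1; set P := pdiv _ in pP.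
  have Pi : P %| m i by apply: dvdn_trans (pdiv_dvd _) (dvdn_gcdl _ _).
  have Pj : P %| m j by apply: dvdn_trans (pdiv_dvd _) (dvdn_gcdr _ _).
  have Pd : ~~ (P %| d).
    apply/negP => Pd; move: Pi; rewrite /m -addn1 dvdn_addr ?dvdn_mull // dvdn1.
    by move=> /eqP P1; rewrite P1 in pP.
  have : P %| m j - m i by apply: dvdn_sub.
  rewrite /m subSS -mulnBl subSS Euclid_dvdM // (negbTE Pd) orbF => PB.
  case/negP: Pd; apply: dvdn_fact; rewrite prime_gt0 //=.
  apply: leq_trans (dvdn_leq _ PB) _; first by rewrite subn_gt0.
  by rewrite leq_subLR addnCA (leq_trans (ltnW jn)) // leq_addr.
have [c Hc] := crt n m x cop; exists c, d => k /leP kn.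
have xd : x k <= k.+1 * d.
  apply: leq_trans (leq_pmull _ _) => //; apply: leq_trans (hu k kn) _.
  by apply: (leq_trans (leq_addl n u)); apply: fact_geq.
exists (c %/ m k).
have {1}-> := divn_eq c (m k); rewrite (Hc k kn) modn_small ?ltnS //.
move/leP: xd; rewrite /m -!plusE -!multE => xd; split; lia.
Qed.

Lemma binomial_char b n k c : (Nat.pow 2 n < b)%coq_nat ->
  c = 'C(n, k) <->
  exists A B, (Nat.pow (S b) n = A * Nat.pow b (S k) + c * Nat.pow b k + B
               /\ c < b /\ B < Nat.pow b k)%coq_nat.
Proof.
rewrite -!expn_pow => /ltP hb; split.
  move/(binomial_digit b n k c hb) => [A [B [E h1 h2]]]; exists A, B.
  by split=> //; split; apply/ltP.
move=> [A [B [E [/ltP h1 /ltP h2]]]]; apply/(binomial_digit b n k c hb).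
by exists A, B.
Qed.

Lemma factorial_char r n f : (S (Nat.pow n n) * (n * n) < r)%coq_nat ->
  f = n`! <->
  (f * 'C(r, n) <= Nat.pow r n /\ Nat.pow r n < S f * 'C(r, n))%coq_nat.
Proof.
rewrite -!expn_pow => /ltP hr; split.
  by move/(factorial_quotient r n f hr)/andP => [h1 h2]; split; apply/leP.
by move=> [/leP h1 /leP h2]; apply/(factorial_quotient r n f hr)/andP.
Qed.

Lemma dvdnP_divide d n : (d %| n) <-> Nat.divide d n.
Proof. by split=> [/dvdnP|] H; [exact: H|apply/dvdnP]. Qed.

Lemma eqn_modP d x y :
  x = y %[mod d] <-> (exists s t, x + s * d = y + t * d)%coq_nat.
Proof.
split=> [E|[s [t E]]].
  exists (y %/ d), (x %/ d).
  have := divn_eq x d; have := divn_eq y d; rewrite E.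
  by rewrite -!plusE -!multE; lia.
have {}E : s * d + x = t * d + y by rewrite addnC [RHS]addnC.
by have := congr1 (modn^~ d) E; rewrite !modnMDl.
Qed.

Lemma bounded_forall_char (l r : expr) m y (p : nat -> nat) :
  (forall k, (k < y)%coq_nat -> exists w,
     eval l (env_app m w (scons k p)) = eval r (env_app m w (scons k p))) <->
  (exists u Q N (a : nat -> nat),
    2 < Q /\ y <= Q /\ u < Q /\
    eval l (env_app m (fun=> u) (scons y p)) < Q /\
    eval r (env_app m (fun=> u) (scons y p)) < Q /\
    Nat.divide (Q`! * Q`!) (S N) /\
    (forall i, i < m -> Nat.divide 'C(N, y) 'C(a i, S u)) /\
    exists s t, eval l (env_app m a (scons N p)) + s * 'C(N, y) =
                eval r (env_app m a (scons N p)) + t * 'C(N, y))%coq_nat.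
Proof.
have := bounded_forall l r m y p; move=> [H1 H2]; split.
  move=> H; case: H1 => [k /ltP|]; first exact: H.
  move=> u [Q [N [a [[h1 h2 h3 h4 h5] [h6 h7 h8]]]]]; exists u, Q, N, a.
  do 5 (split; first by apply/leP).
  split; first by apply/dvdnP_divide.
  split; last by apply/eqn_modP.
  by move=> i /ltP lim; apply/dvdnP_divide/h7.
move=> [u [Q [N [a [h1 [h2 [h3 [h4 [h5 [h6 [h7 h8]]]]]]]]]]] k /ltP; apply: H2.
exists u, Q, N, a; split; split; try by apply/leP.
- by apply/dvdnP_divide.
- by move=> i /ltP lim; apply/dvdnP_divide/h7.
- by apply/eqn_modP.
Qed.
End NumberTheory.

Lemma godel_beta n (x : nat -> nat) : exists c d, forall k, k < n ->
  exists q, c = q * (1 + (k + 1) * d) + x k /\ x k <= (k + 1) * d.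
Proof. exact (NumberTheory.godel_beta n x). Qed.

Definition binom : nat -> nat -> nat := binomial.binomial.
Definition factl : nat -> nat := ssrnat.factorial.

Lemma binom_char b n k c : 2 ^ n < b ->
  c = binom n k <->
  exists A B, S b ^ n = A * b ^ S k + c * b ^ k + B /\ c < b /\ B < b ^ k.
Proof. exact (NumberTheory.binomial_char b n k c). Qed.

Lemma factl_char r n f : S (n ^ n) * (n * n) < r ->
  f = factl n <-> f * binom r n <= r ^ n /\ r ^ n < S f * binom r n.
Proof. exact (NumberTheory.factorial_char r n f). Qed.

Lemma bounded_forall (l r : expr) m y (p : nat -> nat) :
  (forall k, k < y -> exists w,
     eval l (env_app m w (scons k p)) = eval r (env_app m w (scons k p))) <->
  (exists u Q N (a : nat -> nat),
    2 < Q /\ y <= Q /\ u < Q /\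
    eval l (env_app m (fun _ => u) (scons y p)) < Q /\
    eval r (env_app m (fun _ => u) (scons y p)) < Q /\
    Nat.divide (factl Q * factl Q) (S N) /\
    (forall i, i < m -> Nat.divide (binom N y) (binom (a i) (S u))) /\
    exists s t, eval l (env_app m a (scons N p)) + s * binom N y =
                eval r (env_app m a (scons N p)) + t * binom N y).
Proof. exact (NumberTheory.bounded_forall_char l r m y p). Qed.

(** * Words and presentations *)

Section Presentation.
Context {X : Type} (R : list (word X)).

Lemma geq_ctx u v x y : geq R u v -> geq R (x ++ u ++ y) (x ++ v ++ y).
Proof.
  induction 1.
  - constructor.
  - apply geq_sym; assumption.
  - eapply geq_trans; eassumption.
  - rewrite <- !app_assoc; simpl. rewrite !(app_assoc x). apply geq_free.
  - rewrite <- !app_assoc. rewrite !(app_assoc x). now apply geq_rel.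
Qed.

#[global] Instance geq_equiv : Equivalence (geq R).
Proof.
  split; [exact (geq_refl R)|exact (geq_sym R)|exact (geq_trans R)].
Qed.

#[global] Instance geq_app : Proper (geq R ==> geq R ==> geq R) (@app (letter X)).
Proof.
  intros u u' Hu v v' Hv. transitivity (u' ++ v).
  - exact (geq_ctx _ _ [] v Hu).
  - pose proof (geq_ctx _ _ u' [] Hv) as H. now rewrite !app_nil_r in H.
Qed.

Lemma linvK (l : letter X) : linv (linv l) = l.
Proof. destruct l as [x []]; reflexivity. Qed.

Lemma winv_app (u v : word X) : winv (u ++ v) = winv v ++ winv u.
Proof. unfold winv. now rewrite map_app, rev_app_distr. Qed.

Lemma winvK (u : word X) : winv (winv u) = u.
Proof.
  unfold winv. rewrite map_rev, rev_involutive, map_map.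
  rewrite <- (map_id u) at 2. apply map_ext, linvK.
Qed.

Lemma geq_mulV u : geq R (u ++ winv u) [].
Proof.
  induction u as [|l u IH]; [reflexivity|].
  change (l :: u) with ([l] ++ u). rewrite winv_app, <- app_assoc, (app_assoc u).
  rewrite IH. exact (geq_free R [] [] l).
Qed.

Lemma geq_Vmul u : geq R (winv u ++ u) [].
Proof. rewrite <- (winvK u) at 2. apply geq_mulV. Qed.

Lemma geq_eqn u v : geq R (u ++ winv v) [] <-> geq R u v.
Proof.
  split; intro H.
  - rewrite <- (app_nil_r u), <- (geq_Vmul v), app_assoc, H. reflexivity.
  - rewrite H. apply geq_mulV.
Qed.

Fixpoint wpow (w : word X) (n : nat) : word X :=
  match n with 0 => [] | S n => w ++ wpow w n end.

Lemma wpow_comm w n : wpow w n ++ w = w ++ wpow w n.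
Proof. induction n; simpl; [now rewrite app_nil_r|now rewrite <- app_assoc, IHn]. Qed.

Lemma wpow_add w n m : wpow w (n + m) = wpow w n ++ wpow w m.
Proof. induction n; simpl; [reflexivity|now rewrite IHn, app_assoc]. Qed.
End Presentation.

Lemma subst_app sigma u v : subst sigma (u ++ v) = subst sigma u ++ subst sigma v.
Proof. apply flat_map_app. Qed.

Lemma subst_winv sigma u : subst sigma (winv u) = winv (subst sigma u).
Proof.
  induction u as [|l u IH]; [reflexivity|].
  change (l :: u) with ([l] ++ u). rewrite winv_app, !subst_app, winv_app, IH.
  f_equal. destruct l as [[g|n] []]; simpl; rewrite ?app_nil_r, ?winvK; reflexivity.
Qed.

(** * Exponentiation by congruences *)

Lemma geometric_mod (D : Z) (n : nat) :
  exists c : Z, ((D + 1) ^ Z.of_nat n - 1 = D * (Z.of_nat n + D * c))%Z.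
Proof.
  induction n as [|n [c IH]]; [exists 0%Z; simpl; ring|].
  exists (c + Z.of_nat n + D * c)%Z.
  rewrite Nat2Z.inj_succ, Z.pow_succ_r by lia.
  replace ((D + 1) ^ Z.of_nat n)%Z with (1 + D * (Z.of_nat n + D * c))%Z by lia.
  unfold Z.succ. ring.
Qed.

Lemma pow_ge_succ (b n : Z) : (2 <= b -> 0 <= n -> n + 1 <= b ^ n)%Z.
Proof.
  intros b2 n0. pattern n. apply natlike_ind; [simpl; lia| |exact n0].
  intros x x0 IH. rewrite Z.pow_succ_r by exact x0. nia.
Qed.

(** [b ^ j - 1] is prime to [b]: the Bezout relation is [- (b ^ j - 1) + b ^ (j - 1) * b = 1]. *)
Lemma pow_pred_coprime (b j n x : Z) :
  (1 <= j -> 0 <= n -> (b ^ j - 1 | b ^ n * x) -> (b ^ j - 1 | x))%Z.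
Proof.
  intros j1 n0. pattern n. apply natlike_ind; [| |exact n0].
  - now rewrite Z.pow_0_r, Z.mul_1_l.
  - intros y y0 IH H. apply IH. apply Z.gauss with b.
    + rewrite Z.pow_succ_r in H by exact y0. now rewrite Z.mul_assoc.
    + apply Zgcd_1_rel_prime, bezout_rel_prime.
      apply (Bezout_intro _ _ _ (-1) (b ^ (j - 1)))%Z.
      replace (b ^ j)%Z with (b ^ (j - 1) * b)%Z; [ring|].
      rewrite Z.mul_comm, <- Z.pow_succ_r by lia. f_equal. lia.
Qed.

(* Since [M = (b^(jk) - 1) / (b^j - 1) * b^A] is congruent to [k b^A] modulo
   [b^j - 1], so are [b^A k] and [b^A b^i]; the size of [j] makes this an equality. *)
Lemma exp_sound (b i k j l A M N : Z) : (2 <= b ->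
  j = i * i + k * k + 3 -> l = j * k -> 0 <= A -> 0 <= A + l -> 0 <= A + i ->
  (b ^ j - 1) * M = b ^ (A + l) - b ^ A ->
  M - b ^ (A + i) = (b ^ j - 1) * N -> 0 <= i /\ k = b ^ i)%Z.
Proof.
  intros b2 hj hl A0 Al Ai E1 E2. set (D := (b ^ j - 1)%Z) in *.
  assert (j3 : (3 <= j)%Z) by nia.
  assert (powD : forall n, (0 <= n -> b ^ (j * n) = (D + 1) ^ n)%Z).
  { intros n n0. unfold D. replace (b ^ j - 1 + 1)%Z with (b ^ j)%Z by ring.
    apply Z.pow_mul_r; lia. }
  assert (D2 : (2 <= D)%Z).
  { unfold D. pose proof (pow_ge_succ b j). lia. }
  (* The geometric quotient is congruent to [k] modulo [D]. When [k] is negative, [b ^ (A + l)] is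
     the smaller power and is factored out instead, the two powers being congruent modulo [D]. *)
  assert (HM : (D | M - k * b ^ A)%Z).
  { destruct (Z_le_gt_dec 0 k) as [k0|k0].
    - destruct (geometric_mod D (Z.to_nat k)) as [c Hc].
      rewrite Z2Nat.id in Hc by lia.
      assert (E : (b ^ (A + l) = b ^ A * (D + 1) ^ k)%Z).
      { rewrite hl, Z.pow_add_r, powD by nia. reflexivity. }
      rewrite E in E1. set (B := (b ^ A)%Z) in *. set (G := ((D + 1) ^ k)%Z) in *.
      assert (D * M = D * (B * (k + D * c)))%Z.
      { rewrite E1. replace G with (1 + D * (k + D * c))%Z by lia. ring. }
      assert (M = B * (k + D * c))%Z by (apply Z.mul_reg_l with D; [lia|assumption]).
      exists (B * c)%Z. subst M. ring.
    - destruct (geometric_mod D (Z.to_nat (- k))) as [c Hc].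
      rewrite Z2Nat.id in Hc by lia.
      assert (E : (b ^ A = b ^ (A + l) * (D + 1) ^ (- k))%Z).
      { rewrite <- powD, <- Z.pow_add_r by nia. f_equal. subst l. ring. }
      rewrite E in E1 |- *.
      set (B := (b ^ (A + l))%Z) in *. set (G := ((D + 1) ^ (- k))%Z) in *.
      assert (D * M = D * (- B * (- k + D * c)))%Z.
      { rewrite E1. replace G with (1 + D * (- k + D * c))%Z by lia. ring. }
      assert (M = - B * (- k + D * c))%Z by (apply Z.mul_reg_l with D; [lia|assumption]).
      exists (- B * c - k * B * (- k + D * c))%Z.
      replace G with (1 + D * (- k + D * c))%Z by lia. subst M. ring. }
  assert (H : (D | k * b ^ A - b ^ (A + i))%Z).
  { replace (k * b ^ A - b ^ (A + i))%Z
      with ((M - b ^ (A + i)) - (M - k * b ^ A))%Z by ring.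
    apply Z.divide_sub_r; [rewrite E2; apply Z.divide_factor_l|exact HM]. }
  (* The squares in [j] dominate the absolute values of [i] and [k], and the summand 3 leaves a
     factor 8 to spare; so the differences below, being multiples of [D] smaller than [D],
     vanish. *)
  assert (bound : (forall x y, 1 <= y -> Z.abs i <= x -> Z.abs k <= y - 1 ->
    b ^ Z.abs k = y -> b ^ Z.abs i = x -> x + y * x < D)%Z).
  { intros x y y1 hx hy Ey Ex. unfold D.
    assert (b ^ 3 * (x * y) <= b ^ j)%Z.
    { subst x y. rewrite <- !Z.pow_add_r by lia.
      assert (sq : forall z, (Z.abs z <= z * z)%Z) by (intro z; nia).
      pose proof (sq i). pose proof (sq k). apply Z.pow_le_mono_r; lia. }
    assert (8 <= b ^ 3)%Z by (apply (Z.pow_le_mono_l 2 b 3); lia).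
    assert (1 <= x)%Z by (subst x; pose proof (pow_ge_succ b (Z.abs i)); lia).
    nia. }
  pose proof (pow_ge_succ b (Z.abs k) b2 ltac:(lia)) as hk.
  pose proof (pow_ge_succ b (Z.abs i) b2 ltac:(lia)) as hi.
  specialize (bound (b ^ Z.abs i) (b ^ Z.abs k) ltac:(lia) ltac:(lia) ltac:(lia)
    eq_refl eq_refl)%Z.
  assert (small : forall x, (D | x)%Z -> (Z.abs x < D)%Z -> x = 0%Z).
  { intros x [c Hc] hx. assert (c = 0)%Z by nia. subst c. lia. }
  destruct (Z_le_gt_dec 0 i) as [i0|i0].
  - split; [exact i0|].
    rewrite Z.pow_add_r in H by lia.
    replace (k * b ^ A - b ^ A * b ^ i)%Z with (b ^ A * (k - b ^ i))%Z in H by ring.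
    apply pow_pred_coprime, small in H; [lia| | |]; try lia.
    rewrite (Z.abs_eq i) in * by lia. nia.
  (* For negative [i] the congruence becomes [k * b ^ (- i) = 1], impossible since
     [b ^ (- i) >= 2]. *)
  - exfalso. replace A with (A + i + - i)%Z in H at 1 by ring.
    rewrite Z.pow_add_r in H by lia.
    replace (k * (b ^ (A + i) * b ^ (- i)) - b ^ (A + i))%Z
      with (b ^ (A + i) * (k * b ^ (- i) - 1))%Z in H by ring.
    rewrite (Z.abs_neq i) in * by lia.
    set (x := (b ^ (- i))%Z) in *. set (y := (b ^ Z.abs k)%Z) in *.
    apply pow_pred_coprime, small in H; try lia.
    + assert (2 <= x)%Z by lia. destruct (Z_le_gt_dec k 0); nia.
    + assert (Z.abs k * x <= y * x)%Z by nia.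
      assert (Z.abs (k * x) = Z.abs k * x)%Z by nia. lia.
Qed.

(** * Existential formulas over a presented group *)

(* In de Bruijn notation: [GEx] binds variable 0. *)
Inductive gfm := GEq (l r : word sym) | GAnd (f g : gfm) | GEx (f : gfm).

Definition wren (f : nat -> nat) (w : word sym) : word sym :=
  map (fun l => (match fst l with Const g => Const g | Var n => Var (f n) end, snd l)) w.

Definition up (f : nat -> nat) : nat -> nat := scons 0 (fun i => S (f i)).

Fixpoint gren (f : nat -> nat) (F : gfm) : gfm :=
  match F with
  | GEq l r => GEq (wren f l) (wren f r)
  | GAnd F G => GAnd (gren f F) (gren f G)
  | GEx F => GEx (gren (up f) F)
  end.

Lemma subst_wren f (sigma : nat -> word gen) w :
  subst sigma (wren f w) = subst (fun i => sigma (f i)) w.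
Proof.
  induction w as [|[[g|n] b] w IH]; [reflexivity|..]; simpl; now rewrite IH.
Qed.

Section Formula.
Variable R : list (word gen).

Fixpoint sat (sigma : nat -> word gen) (F : gfm) : Prop :=
  match F with
  | GEq l r => geq R (subst sigma l) (subst sigma r)
  | GAnd F G => sat sigma F /\ sat sigma G
  | GEx F => exists w, sat (scons w sigma) F
  end.

Lemma sat_gren F f sigma : sat sigma (gren f F) <-> sat (fun i => sigma (f i)) F.
Proof.
  revert f sigma. induction F as [l r|F IHF G IHG|F IHF]; intros f sigma; simpl.
  - now rewrite !subst_wren.
  - now rewrite IHF, IHG.
  - assert (E : forall w, (fun i => scons w sigma (up f i)) = scons w (fun i => sigma (f i))).
    { intro w. extensionality i. now destruct i. }
    split; intros [w H]; exists w.
    + apply IHF in H. now rewrite E in H.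
    + apply IHF. now rewrite E.
Qed.

Definition solves (sigma : nat -> word gen) (S : system) : Prop :=
  Forall (fun w => geq R (subst sigma w) []) S.

Fixpoint prenex (F : gfm) (xi : nat -> nat) (k : nat) : system * nat :=
  match F with
  | GEq l r => ([wren xi (l ++ winv r)], k)
  | GAnd F G =>
      let '(S1, k1) := prenex F xi k in
      let '(S2, k2) := prenex G xi k1 in (S1 ++ S2, k2)
  | GEx F => prenex F (scons k xi) (S k)
  end.

Lemma prenex_sound F xi k sigma :
  solves sigma (fst (prenex F xi k)) -> sat (fun i => sigma (xi i)) F.
Proof.
  revert xi k. induction F as [l r|F IHF G IHG|F IHF]; intros xi k H; simpl in *.
  - inversion H as [|? ? H1 _]. subst.
    rewrite subst_wren, subst_app, subst_winv in H1. now apply geq_eqn.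
  - destruct (prenex F xi k) as [S1 k1] eqn:E1.
    destruct (prenex G xi k1) as [S2 k2] eqn:E2.
    apply Forall_app in H as [H1 H2]. split.
    + apply (IHF xi k). now rewrite E1.
    + apply (IHG xi k1). now rewrite E2.
  - exists (sigma k). apply IHF in H.
    replace (scons (sigma k) (fun i => sigma (xi i)))
      with (fun i => sigma (scons k xi i)); [exact H|].
    extensionality i. now destruct i.
Qed.

Definition vars_lt (k : nat) (w : word sym) : Prop :=
  Forall (fun l => match fst l with Const _ => True | Var n => n < k end) w.

Lemma subst_agree sigma sigma' k w : vars_lt k w ->
  (forall i, i < k -> sigma i = sigma' i) -> subst sigma w = subst sigma' w.
Proof.
  intros H E. induction H as [|[[g|n] b] w Hl _ IH]; [reflexivity|..]; simpl in *.
  - now rewrite IH.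
  - now rewrite IH, (E n Hl).
Qed.

Lemma wren_vars_lt xi k w : (forall i, xi i < k) -> vars_lt k (wren xi w).
Proof.
  intro H. apply Forall_map, Forall_forall. intros [[g|n] b] _; simpl; auto.
Qed.

Lemma prenex_vars F xi k : (forall i, xi i < k) ->
  k <= snd (prenex F xi k) /\ Forall (vars_lt (snd (prenex F xi k))) (fst (prenex F xi k)).
Proof.
  revert xi k. induction F as [l r|F IHF G IHG|F IHF]; intros xi k H; simpl.
  - split; [lia|]. constructor; [now apply wren_vars_lt|constructor].
  - specialize (IHF xi k H). destruct (prenex F xi k) as [S1 k1]. simpl in IHF.
    destruct IHF as [L1 V1].
    specialize (IHG xi k1 ltac:(intro i; specialize (H i); lia)).
    destruct (prenex G xi k1) as [S2 k2]. simpl in *. destruct IHG as [L2 V2].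
    split; [lia|]. apply Forall_app. split; [|exact V2].
    eapply Forall_impl; [|exact V1]. intros w Hw. eapply Forall_impl; [|exact Hw].
    intros [[g|n] b]; simpl; lia.
  - specialize (IHF (scons k xi) (S k)).
    destruct IHF as [L V].
    + intros [|i]; simpl; [lia|]. specialize (H i). lia.
    + split; [lia|exact V].
Qed.

(** Each existential quantifier assigns its witness to the fresh unknown [k]. By [prenex_vars], the
    values chosen for the second conjunct leave the first one solved, since they only affect later
    unknowns. *)
Lemma prenex_complete F xi k sigma : (forall i, xi i < k) ->
  sat (fun i => sigma (xi i)) F ->
  exists sigma', (forall i, i < k -> sigma' i = sigma i) /\
                 solves sigma' (fst (prenex F xi k)).
Proof.
  revert xi k sigma. induction F as [l r|F IHF G IHG|F IHF]; intros xi k sigma Hxi H;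
    simpl in *.
  - exists sigma. split; [reflexivity|]. constructor; [|constructor].
    rewrite subst_wren, subst_app, subst_winv. now apply geq_eqn.
  - destruct H as [HF HG].
    destruct (IHF xi k sigma Hxi HF) as [s1 [A1 S1]].
    destruct (prenex_vars F xi k Hxi) as [L1 V1].
    destruct (prenex F xi k) as [T1 k1]. simpl in *.
    assert (Hxi1 : forall i, xi i < k1) by (intro i; specialize (Hxi i); lia).
    destruct (IHG xi k1 s1 Hxi1) as [s2 [A2 S2]].
    { replace (fun i => s1 (xi i)) with (fun i => sigma (xi i)); [exact HG|].
      extensionality i. now rewrite A1. }
    destruct (prenex G xi k1) as [T2 k2]. simpl in *.
    exists s2. split; [intros i Hi; rewrite A2, A1 by lia; reflexivity|].
    apply Forall_app. split; [|exact S2].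
    apply Forall_forall. intros w Hw. unfold solves in S1.
    rewrite Forall_forall in S1, V1.
    rewrite (subst_agree s2 s1 k1 w); [now apply S1|now apply V1|exact A2].
  - destruct H as [w H].
    set (s1 := fun i => if Nat.eqb i k then w else sigma i).
    destruct (IHF (scons k xi) (S k) s1) as [s2 [A2 S2]].
    + intros [|i]; simpl; [lia|]. specialize (Hxi i). lia.
    + replace (fun i => s1 (scons k xi i)) with (scons w (fun i => sigma (xi i)));
        [exact H|].
      extensionality i. unfold s1. destruct i; simpl; [now rewrite Nat.eqb_refl|].
      destruct (Nat.eqb_spec (xi i) k); [specialize (Hxi i); lia|reflexivity].
    + exists s2. split; [|exact S2]. intros i Hi. rewrite A2 by lia.
      unfold s1. destruct (Nat.eqb_spec i k); [lia|reflexivity].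
Qed.
End Formula.

(** * Definability of arithmetic in the group *)

(* An element of the product of the integral Heisenberg group, with coordinates
   [hs], [ht], [hz], and of the affine group of the line acting by
   [x |-> p^hs q^ht x + tr]. *)
Record rep := Rep { hs : Z; ht : Z; hz : Z; tr : R }.

Section Group.
Variables (p q : Z).
Hypotheses (hp : prime p) (hq : prime q) (hpq : p <> q).

Notation R := (bs_relators p q).
Notation "u == v" := (geq R u v) (at level 70).
Notation a := ([(Ga, false)] : word gen).
Notation s := ([(Gs, false)] : word gen).
Notation t := ([(Gt, false)] : word gen).
Notation st := ([(Gs, false); (Gt, false)] : word gen).

Definition scale (i j : Z) : Rdefinitions.R :=
  (powerRZ (IZR p) i * powerRZ (IZR q) j)%R.

Lemma p_ge2 : (2 <= p)%Z. Proof. apply prime_ge_2, hp. Qed.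
Lemma q_ge2 : (2 <= q)%Z. Proof. apply prime_ge_2, hq. Qed.

Lemma p_neq0 : IZR p <> 0%R.
Proof. apply not_0_IZR. pose proof p_ge2. lia. Qed.
Lemma q_neq0 : IZR q <> 0%R.
Proof. apply not_0_IZR. pose proof q_ge2. lia. Qed.

Lemma scale_add i j i' j' : scale (i + i') (j + j') = (scale i j * scale i' j')%R.
Proof.
  unfold scale. rewrite !powerRZ_add by (apply p_neq0 || apply q_neq0). ring.
Qed.

Lemma scale0 : scale 0 0 = 1%R.
Proof. unfold scale. simpl. ring. Qed.

Lemma scale_neq0 i j : scale i j <> 0%R.
Proof.
  unfold scale. apply Rmult_integral_contrapositive_currified;
    apply powerRZ_NOR; [apply p_neq0|apply q_neq0].
Qed.

Lemma scale_IZR i j : (0 <= i -> 0 <= j -> scale i j = IZR (p ^ i * q ^ j))%Z.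
Proof.
  intros i0 j0. unfold scale. rewrite mult_IZR. f_equal.
  - rewrite <- (Z2Nat.id i) by lia. now rewrite <- pow_powerRZ, pow_IZR.
  - rewrite <- (Z2Nat.id j) by lia. now rewrite <- pow_powerRZ, pow_IZR.
Qed.

Lemma scale_diag n : (0 <= n)%Z -> scale n n = IZR ((p * q) ^ n).
Proof. intro. rewrite scale_IZR by assumption. now rewrite Z.pow_mul_l. Qed.

Lemma prime_pow_neq x y (m n : Z) : prime x -> prime y -> x <> y ->
  (0 < m -> 0 <= n -> x ^ m <> y ^ n)%Z.
Proof.
  intros hx hy hxy m0 n0 E. apply hxy, (prime_power_prime x y n); [assumption..|].
  rewrite <- E. exists (x ^ (m - 1))%Z.
  rewrite Z.mul_comm, <- Z.pow_succ_r by lia. f_equal. lia.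
Qed.

(** Unique factorization: exponents of opposite signs would equate a positive power of one prime
    with a power of the other, and exponents of the same sign would give a product above 1 unless
    both vanish. *)
Lemma scale_eq1 i j : scale i j = 1%R -> i = 0%Z /\ j = 0%Z.
Proof.
  intro H.
  assert (nonneg : forall i j, (0 <= i -> 0 <= j)%Z -> scale i j = 1%R ->
    (0 <= i)%Z -> i = 0%Z /\ j = 0%Z).
  { intros x y y0 E x0. specialize (y0 x0). rewrite scale_IZR in E by assumption.
    apply eq_IZR in E.
    pose proof (pow_ge_succ p x p_ge2 x0). pose proof (pow_ge_succ q y q_ge2 y0). nia. }
  destruct (Z_le_gt_dec 0 i) as [i0|i0], (Z_le_gt_dec 0 j) as [j0|j0].
  - apply nonneg; tauto.
  - assert (E : scale 0 (- j) = scale i 0).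
    { rewrite <- (Rmult_1_l (scale 0 (- j))), <- H, <- scale_add. f_equal; ring. }
    rewrite !scale_IZR, !Z.pow_0_r, Z.mul_1_l, Z.mul_1_r in E by lia.
    apply eq_IZR in E. exfalso.
    apply (prime_pow_neq q p (- j) i hq hp); [congruence|lia|lia|exact E].
  - assert (E : scale (- i) 0 = scale 0 j).
    { rewrite <- (Rmult_1_l (scale (- i) 0)), <- H, <- scale_add. f_equal; ring. }
    rewrite !scale_IZR, !Z.pow_0_r, Z.mul_1_l, Z.mul_1_r in E by lia.
    apply eq_IZR in E. exfalso.
    apply (prime_pow_neq p q (- i) j hp hq); [congruence|lia|lia|exact E].
  - destruct (nonneg (- i) (- j))%Z; try lia.
    transitivity (scale i j * scale (- i) (- j))%R; [rewrite H; ring|].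
    rewrite <- scale_add, <- scale0. f_equal; ring.
Qed.

Definition rmul (x y : rep) : rep :=
  Rep (hs x + hs y) (ht x + ht y) (hz x + hz y + hs x * ht y)
      (tr x + scale (hs x) (ht x) * tr y).

Definition rone : rep := Rep 0 0 0 0.

Definition rletter (l : letter gen) : rep :=
  let e := if snd l then (-1)%Z else 1%Z in
  match fst l with
  | Ga => Rep 0 0 0 (IZR e)
  | Gs => Rep e 0 0 0
  | Gt => Rep 0 e 0 0
  end.

Definition rword (w : word gen) : rep := fold_right (fun l => rmul (rletter l)) rone w.

Lemma rep_eq x y : hs x = hs y -> ht x = ht y -> hz x = hz y -> tr x = tr y -> x = y.
Proof. destruct x, y. simpl. congruence. Qed.

Lemma rmulA x y z : rmul x (rmul y z) = rmul (rmul x y) z.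
Proof. apply rep_eq; simpl; [ring..|]. rewrite scale_add. ring. Qed.

Lemma rmul1 x : rmul rone x = x.
Proof. apply rep_eq; simpl; [reflexivity..|ring|]. rewrite scale0. ring. Qed.

Lemma rword_app u v : rword (u ++ v) = rmul (rword u) (rword v).
Proof.
  induction u as [|l u IH]; simpl; [now rewrite rmul1|now rewrite IH, rmulA].
Qed.

Lemma rword1 l : rword [l] = rletter l.
Proof. apply rep_eq; simpl; ring. Qed.

Lemma rword_a (e : bool) n :
  rword (repeat (Ga, e) n) = Rep 0 0 0 (if e then - INR n else INR n).
Proof.
  induction n as [|n IH].
  - simpl. unfold rone. destruct e; f_equal; ring.
  - change (repeat (Ga, e) (S n)) with ([(Ga, e)] ++ repeat (Ga, e) n).
    rewrite rword_app, IH, S_INR.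
    apply rep_eq; destruct e; simpl; try reflexivity; rewrite scale0; ring.
Qed.

(** The relators act trivially: [a] vanishes in the Heisenberg factor, and on the line conjugating
    the unit translation by the homothety of ratio [p] or [q] gives the translation by [p] or
    [q]. *)
Lemma rword_geq u v : u == v -> rword u = rword v.
Proof.
  induction 1 as [| | |u v l|u r v Hr]; try congruence.
  - change (l :: linv l :: v) with ([l; linv l] ++ v).
    rewrite !rword_app. replace (rword [l; linv l]) with rone; [now rewrite rmul1|].
    destruct l as [[] []]; apply rep_eq; simpl; try reflexivity;
      try rewrite scale0; try ring.
  - rewrite !rword_app. replace (rword r) with rone; [now rewrite rmul1|].
    assert (E : forall k, (2 <= k)%Z -> apow (- k) = repeat (Ga, true) (Z.to_nat k)).
    { intros k k2. unfold apow. destruct (Z.leb_spec 0 (- k)); [lia|].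
      do 2 f_equal. lia. }
    assert (I : forall k, (2 <= k)%Z -> INR (Z.to_nat k) = IZR k).
    { intros k k2. rewrite INR_IZR_INZ, Z2Nat.id by lia. reflexivity. }
    pose proof p_ge2. pose proof q_ge2.
    destruct Hr as [<-|[<-|[]]]; rewrite rword_app, E, rword_a, I by assumption;
      apply rep_eq; simpl; try reflexivity; rewrite ?scale0; unfold scale; simpl; ring.
Qed.

Definition es w := hs (rword w).
Definition et w := ht (rword w).
Definition er w := tr (rword w).

Lemma es_app u v : es (u ++ v) = (es u + es v)%Z.
Proof. unfold es. now rewrite rword_app. Qed.
Lemma et_app u v : et (u ++ v) = (et u + et v)%Z.
Proof. unfold et. now rewrite rword_app. Qed.
Lemma er_app u v : er (u ++ v) = (er u + scale (es u) (et u) * er v)%R.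
Proof. unfold er. now rewrite rword_app. Qed.

Lemma es_winv u : es (winv u) = (- es u)%Z.
Proof.
  pose proof (rword_geq _ _ (geq_mulV R u)) as H. apply (f_equal hs) in H.
  fold (es (u ++ winv u)) in H. rewrite es_app in H. simpl in H. lia.
Qed.
Lemma et_winv u : et (winv u) = (- et u)%Z.
Proof.
  pose proof (rword_geq _ _ (geq_mulV R u)) as H. apply (f_equal ht) in H.
  fold (et (u ++ winv u)) in H. rewrite et_app in H. simpl in H. lia.
Qed.
Lemma er_mulV u : (er u + scale (es u) (et u) * er (winv u) = 0)%R.
Proof.
  pose proof (rword_geq _ _ (geq_mulV R u)) as H. apply (f_equal tr) in H.
  fold (er (u ++ winv u)) in H. now rewrite er_app in H.
Qed.

Lemma er_conj u v : es v = 0%Z -> et v = 0%Z ->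
  er (u ++ v ++ winv u) = (scale (es u) (et u) * er v)%R.
Proof.
  intros E1 E2. rewrite !er_app, E1, E2, scale0. pose proof (er_mulV u). lra.
Qed.

Lemma er_conj_app u v w : es v = 0%Z -> et v = 0%Z ->
  er (u ++ v ++ winv u ++ w) = (scale (es u) (et u) * er v + er w)%R.
Proof.
  intros E1 E2. rewrite (app_assoc v), (app_assoc u), er_app, er_conj by assumption.
  rewrite !es_app, !et_app, es_winv, et_winv, E1, E2.
  replace (es u + (0 + - es u))%Z with 0%Z by ring.
  replace (et u + (0 + - et u))%Z with 0%Z by ring. rewrite scale0. ring.
Qed.

(** In the Heisenberg group [u v] and [v u] have central coordinates differing by this
    determinant. *)
Lemma comm_det u v : u ++ v == v ++ u -> (es u * et v = es v * et u)%Z.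
Proof.
  intro H. apply rword_geq, (f_equal hz) in H. rewrite !rword_app in H. simpl in H.
  unfold es, et. lia.
Qed.

(** A nonzero translation commutes only with affine maps of ratio 1, to which [scale_eq1]
    applies. *)
Lemma comm_tr u v : u ++ v == v ++ u -> es v = 0%Z -> et v = 0%Z -> er v <> 0%R ->
  es u = 0%Z /\ et u = 0%Z.
Proof.
  intros H E1 E2 E3. apply rword_geq, (f_equal tr) in H.
  fold (er (u ++ v)) (er (v ++ u)) in H. rewrite !er_app, E1, E2, scale0 in H.
  apply scale_eq1. apply (Rmult_eq_reg_r (er v)); [lra|exact E3].
Qed.

(** Translation lengths are fractions whose denominators are powers of [p q]; clearing these turns
    equations in the group into the integer ones of [exp_sound]. *)
Lemma er_integral w :
  exists e n, (0 <= e)%Z /\ (er w * scale e e = IZR n)%R.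
Proof.
  induction w as [|l w [e [n [e0 IH]]]].
  - exists 0%Z, 0%Z. split; [lia|]. unfold er. simpl. ring.
  - change (l :: w) with ([l] ++ w).
    exists (e + 1)%Z.
    assert (Sm : scale e e = IZR ((p * q) ^ e)) by now apply scale_diag.
    assert (P0 := p_neq0). assert (Q0 := q_neq0).
    assert (S1 : scale (e + 1) (e + 1) = (IZR p * IZR q * scale e e)%R).
    { rewrite scale_add. unfold scale at 2. simpl. ring. }
    rewrite er_app.
    assert (Ha : forall x : Z, exists n', (0 <= e + 1)%Z /\
      ((IZR x + er w) * scale (e + 1) (e + 1) = IZR n')%R).
    { intro x. exists (x * (p * q) * (p * q) ^ e + p * q * n)%Z. split; [lia|].
      rewrite S1, plus_IZR, !mult_IZR, <- IH, <- Sm. ring. }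
    (* A letter acts by the ratio [y / z], and the extra factor [p q] turns it into the integer
       [x]. *)
    assert (Hm : forall x y z : Z, (IZR x * IZR z = IZR p * IZR q * IZR y)%R ->
      IZR z <> 0%R -> exists n', (0 <= e + 1)%Z /\
      ((0 + IZR y / IZR z * er w) * scale (e + 1) (e + 1) = IZR n')%R).
    { intros x y z E z0. exists (x * n)%Z. split; [lia|].
      rewrite S1, mult_IZR, <- IH. apply (Rmult_eq_reg_r (IZR z)); [|exact z0].
      transitivity (IZR p * IZR q * IZR y * (er w * scale e e))%R; [field; exact z0|].
      rewrite <- E. ring. }
    unfold es, et, er at 1. rewrite rword1.
    destruct l as [[] []]; simpl; rewrite ?scale0, ?Rmult_1_l.
    + apply Ha.
    + apply Ha.
    + replace (scale (-1) 0) with (1 / IZR p)%R by (unfold scale; simpl; field; exact P0).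
      apply (Hm q); [ring|exact P0].
    + replace (scale 1 0) with (IZR p / 1)%R by (unfold scale; simpl; field).
      apply (Hm (p * q * p)%Z); [rewrite !mult_IZR; ring|lra].
    + replace (scale 0 (-1)) with (1 / IZR q)%R by (unfold scale; simpl; field; exact Q0).
      apply (Hm p); [ring|exact Q0].
    + replace (scale 0 1) with (IZR q / 1)%R by (unfold scale; simpl; field).
      apply (Hm (p * q * q)%Z); [rewrite !mult_IZR; ring|lra].
Qed.

(** * Conjugation of powers of [a] *)

Notation ap n := (repeat (Ga, false) n).

Lemma ap_add n m : ap (n + m) = ap n ++ ap m.
Proof. apply repeat_app. Qed.

Lemma conj_ap w c : w ++ a == ap c ++ w ->
  forall n, w ++ ap n == ap (c * n) ++ w.
Proof.
  intros H n. induction n as [|n IH].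
  - rewrite Nat.mul_0_r. simpl. now rewrite app_nil_r.
  - change (ap (S n)) with (a ++ ap n). rewrite app_assoc, H, <- app_assoc, IH.
    rewrite app_assoc, <- ap_add. replace (c * S n) with (c + c * n) by lia. reflexivity.
Qed.

Lemma conj_wpow w c : w ++ a == ap c ++ w ->
  forall k n, wpow w k ++ ap n == ap (c ^ k * n) ++ wpow w k.
Proof.
  intros H k. induction k as [|k IH]; intro n.
  - simpl. now rewrite Nat.add_0_r, app_nil_r.
  - simpl. rewrite <- app_assoc, IH, app_assoc, (conj_ap w c H), <- app_assoc.
    now rewrite Nat.mul_assoc.
Qed.

Lemma apow_neg k : (2 <= k)%Z -> apow (- k) = winv (ap (Z.to_nat k)).
Proof.
  intro k2. unfold apow. destruct (Z.leb_spec 0 (- k)); [lia|].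
  unfold winv. rewrite map_repeat, rev_repeat. now replace (- - k)%Z with k by lia.
Qed.

Lemma s_conj : s ++ a == ap (Z.to_nat p) ++ s.
Proof.
  assert (H : [(Gs, false); (Ga, false); (Gs, true)] == ap (Z.to_nat p)).
  { apply geq_eqn. rewrite <- apow_neg by apply p_ge2.
    rewrite <- (app_nil_r (_ ++ apow (- p))). apply (geq_rel R []). now left. }
  rewrite <- H. symmetry. exact (geq_free R [(Gs, false); (Ga, false)] [] (Gs, true)).
Qed.

Lemma t_conj : t ++ a == ap (Z.to_nat q) ++ t.
Proof.
  assert (H : [(Gt, false); (Ga, false); (Gt, true)] == ap (Z.to_nat q)).
  { apply geq_eqn. rewrite <- apow_neg by apply q_ge2.
    rewrite <- (app_nil_r (_ ++ apow (- q))). apply (geq_rel R []). now right; left. }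
  rewrite <- H. symmetry. exact (geq_free R [(Gt, false); (Ga, false)] [] (Gt, true)).
Qed.

Definition base := Z.to_nat p * Z.to_nat q.

Lemma st_conj : st ++ a == ap base ++ st.
Proof.
  change st with (s ++ t). rewrite <- app_assoc, t_conj, app_assoc.
  rewrite (conj_ap s _ s_conj), <- app_assoc. reflexivity.
Qed.

Lemma conj_inv w u v : w ++ u == v ++ w -> winv w ++ v == u ++ winv w.
Proof.
  intro H. transitivity (winv w ++ (v ++ w) ++ winv w).
  - rewrite <- !app_assoc, geq_mulV, app_nil_r. reflexivity.
  - rewrite <- H, <- app_assoc, app_assoc, geq_Vmul. reflexivity.
Qed.

Notation A i j := (ap (Z.to_nat (p ^ i * q ^ j))).

Lemma s_move i j : (0 <= i -> 0 <= j -> s ++ A i j == A (i + 1) j ++ s)%Z.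
Proof.
  intros i0 j0. rewrite (conj_ap s _ s_conj), <- Z2Nat.inj_mul.
  - rewrite Z.pow_add_r, Z.pow_1_r by lia.
    now replace (p ^ i * p * q ^ j)%Z with (p * (p ^ i * q ^ j))%Z by ring.
  - pose proof p_ge2. lia.
  - pose proof p_ge2. pose proof q_ge2.
    apply Z.mul_nonneg_nonneg; apply Z.pow_nonneg; lia.
Qed.

Lemma t_move i j : (0 <= i -> 0 <= j -> t ++ A i j == A i (j + 1) ++ t)%Z.
Proof.
  intros i0 j0. rewrite (conj_ap t _ t_conj), <- Z2Nat.inj_mul.
  - rewrite (Z.pow_add_r q), Z.pow_1_r by lia.
    now replace (p ^ i * (q ^ j * q))%Z with (q * (p ^ i * q ^ j))%Z by ring.
  - pose proof q_ge2. lia.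
  - pose proof p_ge2. pose proof q_ge2.
    apply Z.mul_nonneg_nonneg; apply Z.pow_nonneg; lia.
Qed.

(** Conjugation by [w] multiplies exponents of [a] by [p ^ es w * q ^ et w]. This can be carried out
    letter by letter as long as no negative power of [p] or [q] appears on the way; [E] leaves
    enough room for all suffixes of [w]. *)
Lemma word_move w : exists E, (0 <= E)%Z /\ forall i j, (E <= i -> E <= j ->
  0 <= i + es w /\ 0 <= j + et w /\ w ++ A i j == A (i + es w) (j + et w) ++ w)%Z.
Proof.
  induction w as [|l w [E [E0 IH]]].
  - exists 0%Z. split; [lia|]. intros i j i0 j0. unfold es, et. simpl.
    rewrite !Z.add_0_r, app_nil_r. repeat split; assumption || reflexivity.
  - exists (E + 1)%Z. split; [lia|]. intros i j hi hj.
    assert (Hl : (forall x y, 1 <= x -> 1 <= y ->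
      [l] ++ A x y == A (x + es [l]) (y + et [l]) ++ [l])%Z).
    { intros x y x1 y1. unfold es, et. rewrite rword1.
      destruct l as [[] []]; simpl hs; simpl ht; rewrite ?Z.add_0_r.
      - apply (conj_inv a). rewrite (conj_ap a 1) by reflexivity. now rewrite Nat.mul_1_l.
      - rewrite (conj_ap a 1) by reflexivity. now rewrite Nat.mul_1_l.
      - apply (conj_inv s). rewrite s_move by lia.
        now replace (x + -1 + 1)%Z with x by ring.
      - apply s_move; lia.
      - apply (conj_inv t). rewrite t_move by lia.
        now replace (y + -1 + 1)%Z with y by ring.
      - apply t_move; lia. }
    assert (es1 : (-1 <= es [l] <= 1 /\ -1 <= et [l] <= 1)%Z).
    { unfold es, et. rewrite rword1. destruct l as [[] []]; simpl; lia. }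
    destruct (IH i j) as [h1 [h2 h3]]; [lia..|].
    (* Used one step lower, the induction hypothesis shows that the exponents reached are at least
       1, which an inverse letter needs. *)
    destruct (IH (i - 1) (j - 1))%Z as [h4 [h5 _]]; [lia..|].
    change (l :: w) with ([l] ++ w). rewrite es_app, et_app.
    split; [lia|]. split; [lia|].
    rewrite <- app_assoc, h3, app_assoc, Hl, <- app_assoc by lia.
    rewrite <- !Z.add_assoc, (Z.add_comm (es w)), (Z.add_comm (et w)). reflexivity.
Qed.

(** By [word_move], [w] commutes with the power of [a] of exponent [(p q)^E] for a large [E], and
    this power is the conjugate of [a] by [s^E t^E]. *)
Lemma zero_exponents_commute w : es w = 0%Z -> et w = 0%Z ->
  exists u, w ++ u ++ a ++ winv u == (u ++ a ++ winv u) ++ w.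
Proof.
  intros E1 E2. destruct (word_move w) as [E [E0 H]].
  destruct (H E E) as [_ [_ HE]]; [lia..|]. rewrite E1, E2, !Z.add_0_r in HE.
  set (u := wpow s (Z.to_nat E) ++ wpow t (Z.to_nat E)). exists u.
  assert (Hu : u ++ a ++ winv u == A E E).
  { assert (Hu : u ++ a == A E E ++ u).
    { unfold u. change a with (ap 1).
      rewrite <- app_assoc, (conj_wpow t _ t_conj), app_assoc, (conj_wpow s _ s_conj).
      rewrite <- app_assoc. pose proof p_ge2. pose proof q_ge2.
      rewrite Z2Nat.inj_mul by (apply Z.pow_nonneg; lia).
      rewrite !Z2Nat.inj_pow, Nat.mul_1_r by lia. reflexivity. }
    clearbody u. rewrite app_assoc, Hu, <- app_assoc, (geq_mulV R u), app_nil_r. reflexivity. }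
  now rewrite Hu.
Qed.

(** * Formulas for integer arithmetic *)

Notation V i := ([(Var i, false)] : word sym).
Notation Ka := ([(Const Ga, false)] : word sym).
Notation Ks := ([(Const Gs, false)] : word sym).
Notation Kt := ([(Const Gt, false)] : word sym).
Notation Kst := ([(Const Gs, false); (Const Gt, false)] : word sym).
Notation sh n w := (wren (fun i => n + i) w).

Lemma subst_V sigma i : subst sigma (V i) = sigma i.
Proof. apply app_nil_r. Qed.

#[local] Hint Rewrite subst_app subst_winv subst_V subst_wren es_app et_app : gsub.

Definition comm (x y : word sym) : gfm := GEq (x ++ y) (y ++ x).

Lemma sat_comm sigma x y : sat R sigma (comm x y) <->
  subst sigma x ++ subst sigma y == subst sigma y ++ subst sigma x.
Proof. cbn [sat comm]. now rewrite !subst_app. Qed.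

Definition sim (x y : word sym) : gfm :=
  GEx (comm (winv (sh 1 x) ++ sh 1 y) (V 0 ++ Ka ++ winv (V 0))).

(** A conjugate of [a] is a nonzero translation, so by [comm_tr] an element commuting with it has
    vanishing exponent sums; [zero_exponents_commute] is the converse. Both are applied to the
    quotient of [x] and [y]. *)
Lemma sat_sim sigma x y : sat R sigma (sim x y) <->
  es (subst sigma x) = es (subst sigma y) /\ et (subst sigma x) = et (subst sigma y).
Proof.
  unfold sim. cbn [sat].
  assert (E : forall w, sat R (scons w sigma)
    (comm (winv (sh 1 x) ++ sh 1 y) (V 0 ++ Ka ++ winv (V 0))) <->
    (winv (subst sigma x) ++ subst sigma y) ++ w ++ a ++ winv w ==
    (w ++ a ++ winv w) ++ (winv (subst sigma x) ++ subst sigma y)).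
  { intro w. rewrite sat_comm.
    now rewrite !subst_app, !subst_winv, subst_V, !subst_wren. }
  assert (EV : forall f : word gen -> Z, (forall u v, f (u ++ v) = f u + f v)%Z ->
    (forall u, f (winv u) = - f u)%Z -> f a = 0%Z -> forall w, f (w ++ a ++ winv w) = 0%Z).
  { intros f f1 f2 fa w. rewrite !f1, f2, fa. ring. }
  split.
  - intros [w H]. apply E in H.
    apply comm_tr in H.
    + rewrite es_app, et_app, es_winv, et_winv in H. lia.
    + apply EV; [apply es_app|apply es_winv|reflexivity].
    + apply EV; [apply et_app|apply et_winv|reflexivity].
    + rewrite er_conj by reflexivity.
      replace (er a) with 1%R by (unfold er; rewrite rword1; reflexivity).
      rewrite Rmult_1_r. apply scale_neq0.
  - intros [H1 H2].
    destruct (zero_exponents_commute (winv (subst sigma x) ++ subst sigma y)) as [u Hu].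
    + rewrite es_app, es_winv. lia.
    + rewrite et_app, et_winv. lia.
    + exists u. now apply E.
Qed.

Lemma es_wpow w n : es (wpow w n) = (Z.of_nat n * es w)%Z.
Proof. induction n; [reflexivity|]. simpl wpow. rewrite es_app, IHn. lia. Qed.
Lemma et_wpow w n : et (wpow w n) = (Z.of_nat n * et w)%Z.
Proof. induction n; [reflexivity|]. simpl wpow. rewrite et_app, IHn. lia. Qed.

Definition repz (w : word gen) (n : Z) : Prop := es w = n /\ et w = n.

Lemma repz_st n : repz (wpow st n) (Z.of_nat n).
Proof. split; rewrite ?es_wpow, ?et_wpow; unfold es, et; simpl; lia. Qed.

(* [V 0] and [V 1] split [y ~ (k, k)] into [(0, k)] and [(k, 0)]; [V 2] has the
   exponent sums of [z] times [V 0] and is proportional to [x t ~ (n, n + 1)]. *)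
Definition mulG (x y z : word sym) : gfm :=
  GEx (GEx (GEx (GAnd (comm (V 0) Kt) (GAnd (comm (V 1) Ks)
    (GAnd (sim (sh 3 y) (V 0 ++ V 1))
    (GAnd (comm (V 2) (sh 3 x ++ Kt)) (sim (V 2) (sh 3 z ++ V 0)))))))).

(** The vectors [(l, l + k)] and [(n, n + 1)] are proportional, which amounts to [l = n k]. *)
Lemma mulG_sound sigma x y z n k l : sat R sigma (mulG x y z) ->
  repz (subst sigma x) n -> repz (subst sigma y) k -> repz (subst sigma z) l ->
  l = (n * k)%Z.
Proof.
  intros [w2 [w1 [w0 [H0 [H1 [H2 [H3 H4]]]]]]] [x1 x2] [y1 y2] [z1 z2].
  apply sat_comm, comm_det in H0, H1, H3. apply sat_sim in H2, H4.
  autorewrite with gsub in *.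
  cbn [scons Nat.add] in H0, H1, H2, H3, H4. change (fun i => sigma i) with sigma in *.
  change (subst _ Kt) with t in *. change (subst _ Ks) with s in *.
  assert (es t = 0 /\ et t = 1 /\ es s = 1 /\ et s = 0)%Z as [t1 [t2 [s1 s2]]]
    by (repeat split; reflexivity).
  autorewrite with gsub in *.
  rewrite ?x1, ?x2, ?y1, ?y2, ?z1, ?z2, ?t1, ?t2, ?s1, ?s2 in *.
  assert (E1 : es w2 = l) by lia. assert (E2 : et w2 = (l + k)%Z) by lia.
  rewrite E1, E2 in H3. lia.
Qed.

Lemma mulG_complete sigma x y z n k :
  repz (subst sigma x) n -> repz (subst sigma y) (Z.of_nat k) ->
  repz (subst sigma z) (n * Z.of_nat k) -> sat R sigma (mulG x y z).
Proof.
  intros [x1 x2] [y1 y2] [z1 z2].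
  (* The [k]-th power of [x t] has exponent sums [(n k, n k + k)]. *)
  exists (wpow (subst sigma x ++ t) k), (wpow s k), (wpow t k).
  assert (es t = 0 /\ et t = 1 /\ es s = 1 /\ et s = 0)%Z as [t1 [t2 [s1 s2]]]
    by (repeat split; reflexivity).
  cbn [sat]. rewrite !sat_comm, !sat_sim, ?subst_app, ?subst_V, ?subst_wren.
  cbn [scons Nat.add]. change (fun i => sigma i) with sigma.
  change (subst _ Kt) with t. change (subst _ Ks) with s.
  rewrite !wpow_comm.
  rewrite ?es_app, ?et_app, ?es_wpow, ?et_wpow, ?es_app, ?et_app, ?x1, ?x2, ?y1, ?y2,
    ?z1, ?z2, ?t1, ?t2, ?s1, ?s2.
  repeat split; try reflexivity; ring.
Qed.

(* With [V 2 = j = i^2 + k^2 + 3], [V 3 = jk] and the translations [V 4 = m], [V 5 = r]: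
   [m (b^j - 1) = b^(jk) - 1] and [m - b^i = r (b^j - 1)]. *)
Definition expG (x y : word sym) : gfm :=
  GEx (GEx (GEx (GEx (GEx (GEx
    (GAnd (comm (V 0) Kst) (GAnd (comm (V 1) Kst)
    (GAnd (comm (V 2) Kst) (GAnd (comm (V 3) Kst)
    (GAnd (mulG (sh 6 x) (sh 6 x) (V 0)) (GAnd (mulG (sh 6 y) (sh 6 y) (V 1))
    (GAnd (sim (V 2) (V 0 ++ V 1 ++ Kst ++ Kst ++ Kst)) (GAnd (mulG (V 2) (sh 6 y) (V 3))
    (GAnd (comm (V 4) Ka) (GAnd (comm (V 5) Ka)
    (GAnd (GEq (V 2 ++ V 4 ++ winv (V 2) ++ Ka) (V 3 ++ Ka ++ winv (V 3) ++ V 4))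
    (GEq (V 4 ++ V 5)
         (sh 6 x ++ Ka ++ winv (sh 6 x) ++ V 2 ++ V 5 ++ winv (V 2))))))))))))))))))).

Lemma comm_st_repz w : w ++ st == st ++ w -> repz w (es w).
Proof.
  intro H. apply comm_det in H. split; [reflexivity|].
  assert (es st = 1 /\ et st = 1)%Z as [E1 E2] by (split; reflexivity).
  rewrite E1, E2 in H. lia.
Qed.

Lemma er_commutes_a w : w ++ a == a ++ w -> es w = 0%Z /\ et w = 0%Z.
Proof.
  intro H. apply (comm_tr w a H); try reflexivity.
  unfold er. rewrite rword1. simpl. lra.
Qed.

Lemma expG_sound sigma x y i k : sat R sigma (expG x y) ->
  repz (subst sigma x) i -> repz (subst sigma y) k -> (0 <= i /\ k = (p * q) ^ i)%Z.
Proof.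
  intros [r [m [wl [wj [w1 [w0 H]]]]]] hx hy. cbn [sat] in H.
  destruct H as [C0 [C1 [C2 [C3 [M0 [M1 [Sj [Ml [Cm [Cr [E1 E2]]]]]]]]]]].
  apply sat_comm in C0, C1, C2, C3, Cm, Cr.
  autorewrite with gsub in C0, C1, C2, C3, Cm, Cr. cbn [scons] in C0, C1, C2, C3, Cm, Cr.
  apply comm_st_repz in C0, C1, C2, C3. apply er_commutes_a in Cm, Cr.
  apply (mulG_sound _ _ _ _ i i (es w0)) in M0;
    rewrite ?subst_wren, ?subst_V; [|assumption..].
  apply (mulG_sound _ _ _ _ k k (es w1)) in M1;
    rewrite ?subst_wren, ?subst_V; [|assumption..].
  apply (mulG_sound _ _ _ _ (es wj) k (es wl)) in Ml;
    rewrite ?subst_wren, ?subst_V; [|assumption..].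
  apply sat_sim in Sj as [Sj _].
  rewrite !subst_app, !subst_V in Sj. cbn [scons] in Sj.
  change (subst _ Kst) with st in Sj. rewrite !es_app in Sj.
  replace (es st) with 1%Z in Sj by reflexivity.
  cbn [sat] in E1, E2. autorewrite with gsub in E1, E2.
  cbn [scons Nat.add] in E1, E2. change (subst _ Ka) with a in E1, E2.
  change (fun i => sigma i) with sigma in *.
  set (X := subst sigma x) in *.
  assert (era : er a = 1%R) by (unfold er; now rewrite rword1).
  (* Comparing translation lengths turns the last two group equations into identities between
     [er m], [er r] and powers of [p q]. *)
  apply rword_geq, (f_equal tr) in E1, E2.
  change (er (wj ++ m ++ winv wj ++ a) = er (wl ++ a ++ winv wl ++ m)) in E1.
  change (er (m ++ r) = er (X ++ a ++ winv X ++ wj ++ r ++ winv wj)) in E2.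
  destruct Cm as [m1 m2], Cr as [r1 r2].
  rewrite !er_conj_app, era in E1 by (reflexivity || assumption).
  rewrite er_app, er_conj_app, er_conj, era, m1, m2, scale0, Rmult_1_l in E2
    by (reflexivity || assumption).
  destruct C2 as [_ j2], C3 as [_ l2], hx as [x1 x2]. fold X in x1, x2.
  rewrite ?j2, ?l2 in E1. rewrite x1, x2, j2 in E2.
  set (j := es wj) in *. set (l := es wl) in *.
  destruct (er_integral m) as [em [nm [em0 Hm]]].
  destruct (er_integral r) as [er' [nr [er0 Hr]]].
  (* Large enough to clear the denominators of [m] and [r] and to make [A + i] and [A + l]
     nonnegative, the signs of [i] and [l] being still unknown. *)
  set (A := (em + er' + Z.abs i + Z.abs l)%Z).
  assert (hA : (em <= A /\ er' <= A /\ 0 <= A + i /\ 0 <= A + l)%Z) by (unfold A; lia).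
  clearbody A.
  assert (lift : forall e n (x : Rdefinitions.R), (0 <= e <= A)%Z ->
    (x * scale e e = IZR n)%R -> (x * scale A A = IZR (n * (p * q) ^ (A - e)))%R).
  { intros e n x' he Hx. replace A with (e + (A - e))%Z at 1 2 by ring.
    rewrite scale_add, <- Rmult_assoc, Hx, scale_diag, mult_IZR by lia. reflexivity. }
  apply (lift em nm (er m) ltac:(lia)) in Hm. apply (lift er' nr (er r) ltac:(lia)) in Hr.
  set (M := (nm * (p * q) ^ (A - em))%Z) in Hm.
  set (N := (nr * (p * q) ^ (A - er'))%Z) in Hr. clearbody M N.
  assert (hj : j = (i * i + k * k + 3)%Z) by lia.
  apply (exp_sound (p * q) i k j l A M N); try assumption; try lia.
  - pose proof p_ge2. pose proof q_ge2. nia.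
  - apply eq_IZR. rewrite mult_IZR, !minus_IZR, <- !scale_diag, <- Hm by nia.
    rewrite scale_add. nra.
  - apply eq_IZR. rewrite mult_IZR, !minus_IZR, <- !scale_diag, <- Hm, <- Hr by nia.
    rewrite scale_add. nra.
Qed.

(** The witnesses are [M = 1 + B + ... + B^(k-1)] and, for [B > 1], [N = (M - k) / (B - 1)]; the
    equations avoid subtraction. *)
Lemma geometric_sum (B k : nat) :
  exists M N, B * M + 1 = B ^ k + M /\ M + N = k + B * N.
Proof.
  induction k as [|k [M [N [H1 H2]]]].
  - exists 0, 0. simpl. lia.
  - exists (B ^ k + M), (N + M). rewrite Nat.pow_succ_r'. lia.
Qed.

Lemma st_conj_eq n m : wpow st n ++ ap m ++ winv (wpow st n) == ap (base ^ n * m).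
Proof.
  rewrite app_assoc, (conj_wpow st _ st_conj), <- app_assoc.
  rewrite (geq_mulV R (wpow st n)), app_nil_r. reflexivity.
Qed.

(** The equations must hold in the group and not only in its representation; hence the canonical
    elements [(s t)^n] and powers of [a], whose conjugates [st_conj_eq] computes. *)
Lemma expG_complete sigma x y i : subst sigma x = wpow st i ->
  subst sigma y = wpow st (base ^ i) -> sat R sigma (expG x y).
Proof.
  intros hx hy. set (k := base ^ i) in *. set (j := i * i + k * k + 3).
  destruct (geometric_sum (base ^ j) k) as [M [N [H1 H2]]].
  exists (ap N), (ap M), (wpow st (j * k)), (wpow st j), (wpow st (k * k)), (wpow st (i * i)).
  cbn [sat]. rewrite !sat_comm, sat_sim. autorewrite with gsub.
  cbn [scons Nat.add]. change (fun i => sigma i) with sigma. rewrite hx.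
  change (subst _ Kst) with st. change (subst _ Ka) with (ap 1).
  rewrite !wpow_comm.
  assert (apC : forall n m, ap n ++ ap m == ap m ++ ap n).
  { intros n m. rewrite <- !ap_add, Nat.add_comm. reflexivity. }
  assert (hr := repz_st). assert (e1 : es st = 1%Z) by reflexivity.
  assert (e2 : et st = 1%Z) by reflexivity.
  split; [reflexivity|]. split; [reflexivity|].
  split; [reflexivity|]. split; [reflexivity|].
  split.
  { apply (mulG_complete _ _ _ _ (Z.of_nat i) i); rewrite ?subst_wren, ?subst_V;
      cbn [scons Nat.add]; change (fun i => sigma i) with sigma; rewrite ?hx; try apply hr.
    rewrite <- Nat2Z.inj_mul. apply hr. }
  split.
  { apply (mulG_complete _ _ _ _ (Z.of_nat k) k); rewrite ?subst_wren, ?subst_V;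
      cbn [scons Nat.add]; change (fun i => sigma i) with sigma; rewrite ?hy; try apply hr.
    rewrite <- Nat2Z.inj_mul. apply hr. }
  split.
  { rewrite !es_wpow, !et_wpow, e1, e2. unfold j. lia. }
  split.
  { apply (mulG_complete _ _ _ _ (Z.of_nat j) k); rewrite ?subst_wren, ?subst_V;
      cbn [scons Nat.add]; change (fun i => sigma i) with sigma; rewrite ?hy; try apply hr.
    rewrite <- Nat2Z.inj_mul. apply hr. }
  split; [apply apC|]. split; [apply apC|]. split.
  - rewrite (app_assoc (ap M)), (app_assoc (wpow st j)), st_conj_eq.
    rewrite (app_assoc (ap 1)), (app_assoc (wpow st (j * k))), st_conj_eq.
    rewrite <- !ap_add, Nat.mul_1_r, Nat.pow_mul_r, H1. reflexivity.
  - rewrite st_conj_eq, (app_assoc (ap 1)), (app_assoc (wpow st i)), st_conj_eq.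
    rewrite <- !ap_add, Nat.mul_1_r, H2. reflexivity.
Qed.

(** By [expG_sound] only nonnegative exponents have a power, so the existence of [V 0] excludes
    negative integers. *)
Definition natG (x : word sym) : gfm :=
  GAnd (comm x Kst) (GEx (GAnd (comm (V 0) Kst) (expG (sh 1 x) (V 0)))).

Lemma natG_sound sigma x : sat R sigma (natG x) ->
  exists n, repz (subst sigma x) (Z.of_nat n).
Proof.
  intros [H1 [w [H2 H3]]]. apply sat_comm, comm_st_repz in H1, H2.
  exists (Z.to_nat (es (subst sigma x))). rewrite Z2Nat.id; [exact H1|].
  rewrite subst_V in H2. apply (expG_sound _ _ _ (es (subst sigma x)) (es w)) in H3.
  - apply H3.
  - rewrite subst_wren. exact H1.
  - rewrite subst_V. exact H2.
Qed.

Lemma natG_complete sigma x n : subst sigma x = wpow st n -> sat R sigma (natG x).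
Proof.
  intro H. split; [|exists (wpow st (base ^ n)); split].
  - apply sat_comm. rewrite H. now rewrite wpow_comm.
  - apply sat_comm. rewrite subst_V. simpl scons. now rewrite wpow_comm.
  - apply (expG_complete _ _ _ n); [now rewrite subst_wren|now rewrite subst_V].
Qed.

(** A number has many representatives. Soundness is required for all of them, since a solution may
    use any, but completeness only for the canonical [(s t)^n], on which exact group identities are
    available. *)
Definition dio (P : (nat -> nat) -> Prop) : Prop :=
  exists F,
    (forall sigma rho, (forall i, repz (sigma i) (Z.of_nat (rho i))) ->
       sat R sigma F -> P rho) /\
    (forall rho, P rho -> sat R (fun i => wpow st (rho i)) F).

Lemma dio_and P Q : dio P -> dio Q -> dio (fun r => P r /\ Q r).
Proof.
  intros [F [F1 F2]] [G [G1 G2]]. exists (GAnd F G). split.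
  - intros sigma rho H [HF HG]. eauto.
  - intros rho [HP HQ]. split; auto.
Qed.

Lemma dio_ex (P : nat -> (nat -> nat) -> Prop) :
  dio (fun r => P (r 0) (fun i => r (S i))) -> dio (fun r => exists n, P n r).
Proof.
  (* [natG] restricts the quantifier over the whole group to representatives of natural numbers. *)
  intros [F [F1 F2]]. exists (GEx (GAnd (natG (V 0)) F)). split.
  - intros sigma rho H [w [HN HF]]. apply natG_sound in HN as [n Hn].
    rewrite subst_V in Hn. exists n.
    apply (F1 (scons w sigma) (scons n rho)); [|exact HF].
    intros [|i]; [exact Hn|apply H].
  - intros rho [n HP]. exists (wpow st n). split.
    + apply (natG_complete _ _ n). now rewrite subst_V.
    + replace (scons (wpow st n) (fun i => wpow st (rho i)))
        with (fun i => wpow st (scons n rho i)); [exact (F2 (scons n rho) HP)|].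
      extensionality i. now destruct i.
Qed.

Lemma dio_ren P f : dio P -> dio (fun r => P (fun i => r (f i))).
Proof.
  intros [F [F1 F2]]. exists (gren f F). split.
  - intros sigma rho H HF. apply (proj1 (sat_gren R F f sigma)) in HF.
    apply (F1 (fun i => sigma (f i))); [intro i; apply H|exact HF].
  - intros rho HP. apply sat_gren. exact (F2 (fun i => rho (f i)) HP).
Qed.

Lemma dio_ext P Q : (forall r, P r <-> Q r) -> dio Q -> dio P.
Proof.
  intros H [F [F1 F2]]. exists F. split.
  - intros sigma rho Hr HF. apply H. eauto.
  - intros rho HP. apply F2. now apply H.
Qed.

Lemma dio_one x : dio (fun r => r x = 1).
Proof.
  exists (sim (V x) Kst). split.
  - intros sigma rho H HF. apply sat_sim in HF as [HF _].
    rewrite subst_V in HF. destruct (H x) as [H1 _]. rewrite H1 in HF.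
    change (es (subst sigma Kst)) with 1%Z in HF. lia.
  - intros rho E. apply sat_sim. rewrite subst_V, E. split; reflexivity.
Qed.

Lemma dio_plus x y z : dio (fun r => r x + r y = r z).
Proof.
  exists (sim (V x ++ V y) (V z)). split.
  - intros sigma rho H HF. apply sat_sim in HF as [HF _].
    rewrite subst_app, !subst_V, es_app in HF.
    destruct (H x) as [H1 _], (H y) as [H2 _], (H z) as [H3 _]. lia.
  - intros rho E. apply sat_sim. rewrite subst_app, !subst_V, <- wpow_add, E.
    split; reflexivity.
Qed.

Lemma dio_times x y z : dio (fun r => r x * r y = r z).
Proof.
  exists (mulG (V x) (V y) (V z)). split.
  - intros sigma rho H HF.
    apply (mulG_sound _ _ _ _ (Z.of_nat (rho x)) (Z.of_nat (rho y)) (Z.of_nat (rho z))) in HF;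
      rewrite ?subst_V; [lia|apply H..].
  - intros rho E.
    apply (mulG_complete _ _ _ _ (Z.of_nat (rho x)) (rho y)); rewrite ?subst_V;
      try apply repz_st. rewrite <- Nat2Z.inj_mul, E. apply repz_st.
Qed.

Lemma dio_exp x y : dio (fun r => base ^ r x = r y).
Proof.
  exists (expG (V x) (V y)). split.
  - intros sigma rho H HF.
    apply (expG_sound _ _ _ (Z.of_nat (rho x)) (Z.of_nat (rho y))) in HF;
      rewrite ?subst_V; [|apply H..].
    pose proof p_ge2. pose proof q_ge2. apply Nat2Z.inj. destruct HF as [_ ->].
    unfold base. rewrite Nat2Z.inj_pow, Nat2Z.inj_mul, !Z2Nat.id by lia. reflexivity.
  - intros rho E. apply (expG_complete _ _ _ (rho x)); rewrite subst_V; [reflexivity|].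
    now rewrite E.
Qed.

Lemma base_ge2 : 2 <= base.
Proof. unfold base. pose proof p_ge2. pose proof q_ge2. nia. Qed.

End Group.

(** * Reachability for polynomial rewriting systems *)

Lemma env_app_lt {A} m (w r : nat -> A) i : i < m -> env_app m w r i = w i.
Proof. intro. unfold env_app. destruct (Nat.ltb_spec i m); [reflexivity|lia]. Qed.

Lemma env_app_ge {A} m (w r : nat -> A) i : env_app m w r (m + i) = r i.
Proof.
  unfold env_app. destruct (Nat.ltb_spec (m + i) m); [lia|]. f_equal. lia.
Qed.

Lemma env_app_S {A} m (w r : nat -> A) :
  env_app (S m) w r = env_app m w (scons (w m) r).
Proof.
  extensionality i. destruct (Nat.lt_trichotomy i m) as [h|[->|h]].
  - now rewrite !env_app_lt by lia.
  - rewrite env_app_lt by lia. rewrite <- (Nat.add_0_r m) at 4. now rewrite env_app_ge.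
  - replace i with (S m + (i - S m)) by lia. generalize (i - S m). intro j.
    rewrite env_app_ge, Nat.add_succ_comm. now rewrite env_app_ge.
Qed.

(** The assignment [w] is existential, so variables occurring only on the right of a rule are
    guessed. *)
Definition step (rules : list (expr * expr)) (x y : nat) : Prop :=
  exists lr, In lr rules /\ exists w, x = eval (fst lr) w /\ y = eval (snd lr) w.

Definition reach (rules : list (expr * expr)) (x y : nat) : Prop :=
  exists T f, f 0 = x /\ f T = y /\ forall k, k < T -> step rules (f k) (f (S k)).

Definition holds (e : expr * expr) (r : nat -> nat) : Prop :=
  eval (fst e) r = eval (snd e) r.

(* [(l1 - r1)^2 + (l2 - r2)^2 = 0] and [(l1 - r1) (l2 - r2) = 0], without subtraction. *)
Definition kand (e f : expr * expr) : expr * expr :=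
  let (l1, r1) := e in let (l2, r2) := f in
  (EAdd (EAdd (EMul l1 l1) (EMul r1 r1)) (EAdd (EMul l2 l2) (EMul r2 r2)),
   EMul (ECst 2) (EAdd (EMul l1 r1) (EMul l2 r2))).

Definition kor (e f : expr * expr) : expr * expr :=
  let (l1, r1) := e in let (l2, r2) := f in
  (EAdd (EMul l1 l2) (EMul r1 r2), EAdd (EMul l1 r2) (EMul r1 l2)).

Lemma holds_kand e f r : holds (kand e f) r <-> holds e r /\ holds f r.
Proof.
  destruct e as [l1 r1], f as [l2 r2]. unfold holds. simpl.
  generalize (eval l1 r) (eval l2 r) (eval r1 r) (eval r2 r). intros x y z t.
  split; [|intros [-> ->]; ring]. intro H.
  assert (E : ((Z.of_nat x - Z.of_nat z) * (Z.of_nat x - Z.of_nat z) +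
    (Z.of_nat y - Z.of_nat t) * (Z.of_nat y - Z.of_nat t) = 0)%Z) by nia.
  assert (forall u v : Z, (u * u + v * v = 0)%Z -> u = 0%Z /\ v = 0%Z) by (intros; nia).
  apply H0 in E. lia.
Qed.

Lemma holds_kor e f r : holds (kor e f) r <-> holds e r \/ holds f r.
Proof.
  destruct e as [l1 r1], f as [l2 r2]. unfold holds. simpl.
  generalize (eval l1 r) (eval l2 r) (eval r1 r) (eval r2 r). intros x y z t.
  split; [|intros [->| ->]; ring]. intro H.
  assert (E : ((Z.of_nat x - Z.of_nat z) * (Z.of_nat y - Z.of_nat t) = 0)%Z) by nia.
  apply Z.mul_eq_0 in E. lia.
Qed.

Fixpoint eren (f : nat -> nat) (e : expr) : expr :=
  match e with
  | EVar i => EVar (f i)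
  | ECst c => ECst c
  | EAdd e1 e2 => EAdd (eren f e1) (eren f e2)
  | EMul e1 e2 => EMul (eren f e1) (eren f e2)
  end.

Lemma eval_eren f e r : eval (eren f e) r = eval e (fun i => r (f i)).
Proof. induction e; simpl; congruence. Qed.

Fixpoint evars_lt (v : nat) (e : expr) : Prop :=
  match e with
  | EVar i => i < v
  | ECst _ => True
  | EAdd e1 e2 | EMul e1 e2 => evars_lt v e1 /\ evars_lt v e2
  end.

Lemma eval_agree v e r r' : evars_lt v e -> (forall i, i < v -> r i = r' i) ->
  eval e r = eval e r'.
Proof.
  intros H E. induction e; simpl in *; auto; destruct H; rewrite IHe1, IHe2; auto.
Qed.

(** The graph of Goedel's beta function: [x] is the remainder of [C] by [1 + (k + 1) D], written
    with polynomials. *)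
Definition beta (C D k x : nat) : Prop :=
  exists n, C = n * (1 + (k + 1) * D) + x /\ x <= (k + 1) * D.

Lemma beta_inj C D k x y : beta C D k x -> beta C D k y -> x = y.
Proof.
  intros [n [E1 h1]] [n' [E2 h2]].
  apply (Nat.div_mod_unique (1 + (k + 1) * D) n n'); lia.
Qed.

(** One polynomial equation saying that a rule leads from entry [k] to entry [k + 1] of the sequence
    coded by [C] and [D]. Witnesses 0 and 1 are the entries, 2 and 4 the quotients, 3 and 5 the
    slacks of the inequalities in [beta], and those from 6 on the variables of the rule. The false
    equation [0 = 1] is the empty disjunction. *)
Definition kernel (v : nat) (rules : list (expr * expr)) : expr * expr :=
  let K := EVar (6 + v + 0) in
  let C := EVar (6 + v + 1) in
  let D := EVar (6 + v + 2) in
  let bound c := EMul (EAdd K (ECst c)) D in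
  let code c n x := (C, EAdd (EMul (EVar n) (EAdd (ECst 1) (bound c))) (EVar x)) in
  let sh := eren (fun i => 6 + i) in
  kand (code 1 2 0) (kand (EAdd (EVar 0) (EVar 3), bound 1)
  (kand (code 2 4 1) (kand (EAdd (EVar 1) (EVar 5), bound 2)
  (fold_right (fun lr => kor (kand (EVar 0, sh (fst lr)) (EVar 1, sh (snd lr))))
     (ECst 0, ECst 1) rules)))).

Lemma kernel_spec v rules k C D rho :
  (forall lr, In lr rules -> evars_lt v (fst lr) /\ evars_lt v (snd lr)) ->
  (exists w, holds (kernel v rules) (env_app (6 + v) w (scons k (scons C (scons D rho))))) <->
  exists x y, beta C D k x /\ beta C D (S k) y /\ step rules x y.
Proof.
  intro Hv.
  assert (Hr : forall w r, holds (fold_right (fun lr =>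
      kor (kand (EVar 0, eren (fun i => 6 + i) (fst lr))
                (EVar 1, eren (fun i => 6 + i) (snd lr)))) (ECst 0, ECst 1) rules)
      (env_app (6 + v) w r) <->
    exists lr, In lr rules /\ w 0 = eval (fst lr) (fun i => w (6 + i)) /\
                              w 1 = eval (snd lr) (fun i => w (6 + i))).
  { intros w r.
    assert (Ee : forall lr, In lr rules -> forall e, e = fst lr \/ e = snd lr ->
      eval (eren (fun i => 6 + i) e) (env_app (6 + v) w r) = eval e (fun i => w (6 + i))).
    { intros lr Hlr e He. rewrite eval_eren. apply (eval_agree v).
      - destruct (Hv lr Hlr). now destruct He as [->| ->].
      - intros i Hi. apply env_app_lt. lia. }
    clear Hv. induction rules as [|lr rs IH]; cbn [fold_right].
    - split; [intro H; discriminate H|intros [lr [[] _]]].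
    - rewrite holds_kor, holds_kand, IH by (intros lr' H; apply Ee; now right).
      unfold holds. cbn [fst snd].
      rewrite !(Ee lr) by auto using in_eq. cbn [eval].
      split.
      + intros [[H1 H2]|[lr' [H1 H2]]]; [exists lr|exists lr']; auto using in_eq, in_cons.
      + intros [lr' [[->|H1] H2]]; [left; exact H2|right; eauto]. }
  unfold kernel. cbv zeta.
  split.
  - intros [w H]. rewrite !holds_kand, Hr in H. unfold holds in H.
    cbn [fst snd eval] in H. rewrite !env_app_ge in H. cbn [scons] in H.
    rewrite !env_app_lt in H by lia.
    destruct H as [H1 [H2 [H3 [H4 [lr [H5 H6]]]]]].
    exists (w 0), (w 1). split; [exists (w 2); lia|].
    split; [exists (w 4); split; [rewrite H3; f_equal; f_equal|]; lia|].
    exists lr. split; [exact H5|]. eauto.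
  - intros [x [y [[n [H1 H2]] [[n' [H3 H4]] [lr [H5 [w [H6 H7]]]]]]]].
    exists (env_app 6 (fun i => nth i [x; y; n; (k + 1) * D - x; n'; (k + 2) * D - y] 0) w).
    rewrite !holds_kand, Hr. unfold holds.
    cbn [fst snd eval]. rewrite !env_app_ge. cbn [scons].
    rewrite !(env_app_lt (6 + v)) by lia. rewrite !(env_app_lt 6) by lia. cbn [nth].
    replace (S k + 1) with (k + 2) in H3, H4 by lia.
    repeat (split; [lia|]). exists lr. split; [exact H5|].
    split; [rewrite H6|rewrite H7]; f_equal; extensionality i; now rewrite env_app_ge.
Qed.

(** * Resolution of evaluation goals *)

Fixpoint mu_nested_ind (P : mu -> Prop) (Hz : P MZero) (Hs : P MSucc)
  (Hp : forall i, P (MProj i))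
  (Hc : forall f gs, P f -> Forall P gs -> P (MComp f gs))
  (Hr : forall f g, P f -> P g -> P (MPrec f g))
  (Hm : forall f, P f -> P (MMin f)) (f : mu) : P f :=
  let rec := mu_nested_ind P Hz Hs Hp Hc Hr Hm in
  match f with
  | MZero => Hz
  | MSucc => Hs
  | MProj i => Hp i
  | MComp f gs => Hc f gs (rec f)
      ((fix go l : Forall P l :=
          match l with [] => Forall_nil P | g :: l => Forall_cons g (rec g) (go l) end) gs)
  | MPrec f g => Hr f g (rec f) (rec g)
  | MMin f => Hm f (rec f)
  end.

Lemma ev_det f : forall v y y', ev f v y -> ev f v y' -> y = y'.
Proof.
  induction f as [| | |f gs IHf IHg|f g IHf IHg|f IHf] using mu_nested_ind;
    intros v y y' H H'.
  - inversion H; inversion H'; congruence.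
  - inversion H; inversion H'; congruence.
  - inversion H; inversion H'; congruence.
  - inversion H as [| | |? ? ? ws ? Hw Hf| | |]; subst.
    inversion H' as [| | |? ? ? ws' ? Hw' Hf'| | |]; subst.
    assert (ws = ws') as <-.
    { clear - IHg Hw Hw'. revert ws' Hw'.
      induction Hw as [|g w gs ws Hg Hw IH]; intros ws' Hw'; inversion Hw'; subst;
        [reflexivity|]. inversion IHg; subst. f_equal; eauto. }
    eauto.
  - destruct v as [|n v]; [inversion H|].
    revert y y' H H'. induction n as [|n IHn]; intros y y' H H';
      inversion H; inversion H'; subst; [eauto|].
    assert (z = z0) as <- by eauto. eauto.
  - inversion H as [| | | | | |? ? ? H1 H2]; subst.
    inversion H' as [| | | | | |? ? ? H1' H2']; subst.
    destruct (Nat.lt_trichotomy y y') as [h|[h|h]]; [|exact h|].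
    + destruct (H2' y h) as [k Hk]. specialize (IHf _ _ _ H1 Hk). discriminate.
    + destruct (H2 y' h) as [k Hk]. specialize (IHf _ _ _ H1' Hk). discriminate.
Qed.

(** Unlike [cpair] this is visibly a polynomial, as the rewriting rules require. It is injective
    because [(x + y)^2] is the largest square not above it. *)
Definition sqpair (x y : nat) : nat := (x + y) * (x + y) + x.

Lemma pair_inj x y x' y' : sqpair x y = sqpair x' y' -> x = x' /\ y = y'.
Proof.
  unfold sqpair. intro H.
  assert (x + y = x' + y') by nia. assert (x = x') by nia. lia.
Qed.

Inductive pat := PVar (i : nat) | PCst (c : nat) | PSucc (a : pat) | PPair (a b : pat).

Fixpoint peval (a : pat) (w : nat -> nat) : nat :=
  match a with
  | PVar i => w i
  | PCst c => c
  | PSucc a => S (peval a w)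
  | PPair a b => sqpair (peval a w) (peval b w)
  end.

Fixpoint pexpr (a : pat) : expr :=
  match a with
  | PVar i => EVar i
  | PCst c => ECst c
  | PSucc a => EAdd (ECst 1) (pexpr a)
  | PPair a b => EAdd (EMul (EAdd (pexpr a) (pexpr b)) (EAdd (pexpr a) (pexpr b))) (pexpr a)
  end.

Lemma eval_pexpr a w : eval (pexpr a) w = peval a w.
Proof. induction a; simpl; rewrite ?IHa, ?IHa1, ?IHa2; reflexivity. Qed.

Fixpoint encl (v : list nat) : nat :=
  match v with [] => 0 | x :: v => S (sqpair x (encl v)) end.

Fixpoint encm (f : mu) : nat :=
  match f with
  | MZero => sqpair 0 0
  | MSucc => sqpair 1 0
  | MProj i => sqpair 2 i
  | MComp f gs => sqpair 3 (sqpair (encm f)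
      ((fix go l := match l with [] => 0 | g :: l => S (sqpair (encm g) (go l)) end) gs))
  | MPrec f g => sqpair 4 (sqpair (encm f) (encm g))
  | MMin f => sqpair 5 (encm f)
  end.

Fixpoint encml (gs : list mu) : nat :=
  match gs with [] => 0 | g :: gs => S (sqpair (encm g) (encml gs)) end.

(* Argument vectors occur in goals only through their codes, since a step may guess
   a number that is not the code of a vector. *)
Inductive goal :=
| GEv (f : mu) (V y : nat)
| GEvs (gs : list mu) (V W : nat)
| GMin (f : mu) (V n : nat).

Definition valid (G : goal) : Prop :=
  match G with
  | GEv f V y => forall v, V = encl v -> ev f v y
  | GEvs gs V W => forall v, V = encl v ->
      exists ws, W = encl ws /\ Forall2 (fun g w => ev g v w) gs ws
  | GMin f V n => forall v, V = encl v -> forall m, m < n -> exists k, ev f (m :: v) (S k)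
  end.

Definition encg (G : goal) : nat :=
  match G with
  | GEv f V y => sqpair 0 (sqpair (encm f) (sqpair V y))
  | GEvs gs V W => sqpair 1 (sqpair (encml gs) (sqpair V W))
  | GMin f V n => sqpair 2 (sqpair (encm f) (sqpair V n))
  end.

Definition encs (L : list goal) : nat := encl (map encg L).

Local Notation pv := PVar.
Local Notation pgoal k f V y := (PPair (PCst k) (PPair f (PPair V y))).
Local Notation pEv f V y := (pgoal 0 f V y).
Local Notation pEvs f V y := (pgoal 1 f V y).
Local Notation pMin f V y := (pgoal 2 f V y).
Local Notation "x ;; y" := (PSucc (PPair x y)) (at level 60, right associativity).
Local Notation pf k a := (PPair (PCst k) a).

(* Resolution steps on a stack of goals, whose rest is [pv 0]. *)
Definition prules : list (pat * pat) :=
  [ (pEv (pf 0 (PCst 0)) (pv 1) (PCst 0) ;; pv 0, pv 0);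
    (pEv (pf 1 (PCst 0)) (pv 1 ;; pv 2) (PSucc (pv 1)) ;; pv 0, pv 0);
    (pEv (pf 2 (PCst 0)) (pv 1 ;; pv 2) (pv 1) ;; pv 0, pv 0);
    (pEv (pf 2 (pv 1)) (PCst 0) (PCst 0) ;; pv 0, pv 0);
    (pEv (pf 2 (PSucc (pv 1))) (pv 2 ;; pv 3) (pv 4) ;; pv 0,
     pEv (pf 2 (pv 1)) (pv 3) (pv 4) ;; pv 0);
    (pEv (pf 3 (PPair (pv 1) (pv 2))) (pv 3) (pv 4) ;; pv 0,
     pEvs (pv 2) (pv 3) (pv 5) ;; pEv (pv 1) (pv 5) (pv 4) ;; pv 0);
    (pEvs (PCst 0) (pv 1) (PCst 0) ;; pv 0, pv 0);
    (pEvs (pv 1 ;; pv 2) (pv 3) (pv 4 ;; pv 5) ;; pv 0,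
     pEv (pv 1) (pv 3) (pv 4) ;; pEvs (pv 2) (pv 3) (pv 5) ;; pv 0);
    (pEv (pf 4 (PPair (pv 1) (pv 2))) (PCst 0 ;; pv 3) (pv 4) ;; pv 0,
     pEv (pv 1) (pv 3) (pv 4) ;; pv 0);
    (pEv (pf 4 (PPair (pv 1) (pv 2))) (PSucc (pv 3) ;; pv 4) (pv 5) ;; pv 0,
     pEv (pf 4 (PPair (pv 1) (pv 2))) (pv 3 ;; pv 4) (pv 6) ;;
     pEv (pv 2) (pv 3 ;; pv 6 ;; pv 4) (pv 5) ;; pv 0);
    (pEv (pf 5 (pv 1)) (pv 2) (pv 3) ;; pv 0,
     pEv (pv 1) (pv 3 ;; pv 2) (PCst 0) ;; pMin (pv 1) (pv 2) (pv 3) ;; pv 0);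
    (pMin (pv 1) (pv 2) (PCst 0) ;; pv 0, pv 0);
    (pMin (pv 1) (pv 2) (PSucc (pv 3)) ;; pv 0,
     pEv (pv 1) (pv 3 ;; pv 2) (PSucc (pv 4)) ;; pMin (pv 1) (pv 2) (pv 3) ;; pv 0) ].

Definition mrules : list (expr * expr) :=
  map (fun lr => (pexpr (fst lr), pexpr (snd lr))) prules.

Lemma mrules_vars lr : In lr mrules -> evars_lt 7 (fst lr) /\ evars_lt 7 (snd lr).
Proof.
  intro H. repeat destruct H as [<-|H]; [simpl; lia..|destruct H].
Qed.

Lemma step_mrules x y : step mrules x y <->
  exists lr w, In lr prules /\ x = peval (fst lr) w /\ y = peval (snd lr) w.
Proof.
  unfold step, mrules. split.
  - intros [lr [H [w [Hx Hy]]]]. apply in_map_iff in H as [lr' [<- H]].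
    exists lr', w. simpl in Hx, Hy. rewrite !eval_pexpr in *. auto.
  - intros [lr [w [H [Hx Hy]]]]. exists (pexpr (fst lr), pexpr (snd lr)).
    split; [apply in_map_iff; eauto|]. exists w. simpl. now rewrite !eval_pexpr.
Qed.

Lemma reach_refl rules x : reach rules x x.
Proof. exists 0, (fun _ => x). repeat split; lia. Qed.

Lemma reach_step rules x y z : step rules x y -> reach rules y z -> reach rules x z.
Proof.
  intros H [T [f [H0 [HT Hs]]]]. exists (S T), (scons x f).
  split; [reflexivity|]. split; [exact HT|].
  intros [|k] Hk; simpl; [now rewrite H0|apply Hs; lia].
Qed.

Lemma encm_comp f gs : encm (MComp f gs) = sqpair 3 (sqpair (encm f) (encml gs)).
Proof. reflexivity. Qed.

Local Ltac inv_codes :=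
  repeat match goal with
  | H : S _ = S _ |- _ => injection H as H
  | H : 0 = S _ |- _ => discriminate H
  | H : S _ = 0 |- _ => discriminate H
  | H : sqpair _ _ = sqpair _ _ |- _ => apply pair_inj in H as [? ?]
  | H : ?c = ?d |- _ => is_var d; subst d
  | H : ?c = ?d |- _ => is_var c; subst c
  | H : encl ?v = 0 |- _ => destruct v; [|discriminate H]
  | H : encl ?v = S _ |- _ => destruct v; [discriminate H|cbn [encl] in H]
  | H : encml ?v = 0 |- _ => destruct v; [|discriminate H]
  | H : encml ?v = S _ |- _ => destruct v; [discriminate H|cbn [encml] in H]
  end.

(** Codes being injective, the left side of a rule determines the shape of the top goal. The right
    side is again a stack of goals: its function codes are taken from the left, and guessed numbers
    occur only where goals allow arbitrary numbers. Validity passes from the new stack back to the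
    old one. *)
Lemma step_sound L y : step mrules (encs L) y ->
  exists L', y = encs L' /\ (Forall valid L' -> Forall valid L).
Proof.
  intro H. apply step_mrules in H as [lr [w [H [Hx ->]]]].
  destruct L as [|G L].
  { repeat destruct H as [<-|H]; [discriminate Hx..|destruct H]. }
  change (encs (G :: L)) with (S (sqpair (encg G) (encs L))) in Hx.
  repeat destruct H as [<-|H]; cbn [fst snd peval] in *; [..|destruct H].
  all: revert Hx; generalize (w 0) (w 1) (w 2) (w 3) (w 4) (w 5) (w 6);
    intros x0 x1 x2 x3 x4 x5 x6 Hx.
  all: inv_codes; destruct G as [f V n|gs V W|f V n]; cbn [encg] in *; inv_codes.
  all: try match goal with H : encm ?f = sqpair _ _ |- _ =>
    destruct f; first [rewrite encm_comp in H|cbn [encm] in H]; inv_codes end.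
  - exists L. split; [reflexivity|]. intro HL. constructor; [|exact HL].
    intros v _. constructor.
  - exists L. split; [reflexivity|]. intro HL. constructor; [|exact HL].
    intros v Hv. symmetry in Hv. inv_codes. constructor.
  - exists L. split; [reflexivity|]. intro HL. constructor; [|exact HL].
    intros v Hv. symmetry in Hv. inv_codes. apply (ev_proj 0).
  - exists L. split; [reflexivity|]. intro HL. constructor; [|exact HL].
    intros v Hv. symmetry in Hv. inv_codes.
    (* A projection beyond the end of the vector yields the default 0. *)
    replace 0 with (nth i [] 0) at 1 by now destruct i. apply ev_proj.
  - exists (GEv (MProj x1) x3 n :: L). split; [reflexivity|]. rewrite !Forall_cons_iff.
    intros [H1 HL]. split; [|exact HL].
    intros v Hv. symmetry in Hv. inv_codes. specialize (H1 _ eq_refl).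
    inversion H1; subst. apply (ev_proj (S x1) (_ :: _)).
  - exists (GEvs gs V x5 :: GEv f x5 n :: L). split; [reflexivity|].
    rewrite !Forall_cons_iff. intros [H1 [H2 HL]]. split; [|exact HL].
    intros v Hv. destruct (H1 v Hv) as [ws [-> Hw]]. econstructor; [exact Hw|auto].
  - exists L. split; [reflexivity|]. intro HL. constructor; [|exact HL].
    intros v _. exists []. auto.
  - exists (GEv m V x4 :: GEvs gs V x5 :: L). split; [reflexivity|].
    rewrite !Forall_cons_iff. intros [H1 [H2 HL]]. split; [|exact HL].
    intros v Hv. destruct (H2 v Hv) as [ws [-> Hw]]. exists (x4 :: ws). auto.
  - exists (GEv f1 x3 n :: L). split; [reflexivity|]. rewrite !Forall_cons_iff.
    intros [H1 HL]. split; [|exact HL].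
    intros v Hv. symmetry in Hv. inv_codes. constructor. auto.
  - exists (GEv (MPrec f1 f2) (S (sqpair x3 x4)) x6 ::
            GEv f2 (S (sqpair x3 (S (sqpair x6 x4)))) n :: L). split; [reflexivity|].
    rewrite !Forall_cons_iff. intros [H1 [H2 HL]]. split; [|exact HL].
    intros v Hv. symmetry in Hv. inv_codes.
    econstructor; [apply H1|apply H2]; reflexivity.
  - exists (GEv f (S (sqpair n V)) 0 :: GMin f V n :: L). split; [reflexivity|].
    rewrite !Forall_cons_iff. intros [H1 [H2 HL]]. split; [|exact HL].
    intros v ->. constructor; [apply H1; reflexivity|apply H2; reflexivity].
  - exists L. split; [reflexivity|]. intro HL. constructor; [|exact HL].
    intros v _ k Hk. lia.
  - exists (GEv f (S (sqpair x3 V)) (S x4) :: GMin f V x3 :: L). split; [reflexivity|].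
    rewrite !Forall_cons_iff. intros [H1 [H2 HL]]. split; [|exact HL].
    intros v -> k Hk. destruct (Nat.eq_dec k x3) as [->|].
    + exists x4. apply H1. reflexivity.
    + apply H2; [reflexivity|lia].
Qed.

Lemma reach_sound L : reach mrules (encs L) 0 -> Forall valid L.
Proof.
  intros [T [f [H0 [HT H]]]]. revert f L H0 HT H.
  induction T as [|T IH]; intros f L H0 HT H.
  - destruct L; [constructor|]. rewrite H0 in HT. discriminate HT.
  - assert (Hs : step mrules (encs L) (f 1)) by (rewrite <- H0; apply H; lia).
    apply step_sound in Hs as [L' [E HL]]. apply HL, (IH (fun k => f (S k))); auto.
    intros k Hk. apply H. lia.
Qed.

Lemma reach_rule k ws x z : k < length prules ->
  let lr := nth k prules (PCst 0, PCst 0) in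
  let w i := nth i ws 0 in
  peval (fst lr) w = x -> reach mrules (peval (snd lr) w) z -> reach mrules x z.
Proof.
  intros Hk lr w <- H. eapply reach_step; [|exact H]. apply step_mrules.
  exists lr, w. split; [now apply nth_In|auto].
Qed.

Local Ltac rule k ws :=
  apply (reach_rule k ws); [simpl; lia|reflexivity|cbn [nth prules fst snd peval]].

Definition stk (x r : nat) : nat := S (sqpair x r).

(** The rest [r] of the stack is any number that reduces to 0; this continuation form lets the
    subgoals created by a rule be discharged one after another. *)
Lemma reach_complete f : forall v y, ev f v y -> forall r, reach mrules r 0 ->
  reach mrules (stk (encg (GEv f (encl v) y)) r) 0.
Proof.
  induction f as [| |i|f gs IHf IHg|f g IHf IHg|f IHf] using mu_nested_ind;
    intros v y H r Hr.
  - inversion H; subst. rule 0 [r; encl v]. exact Hr.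
  - inversion H as [|x v'| | | | |]; subst. rule 1 [r; x; encl v']. exact Hr.
  - inversion H; subst. clear H. revert v. induction i as [|i IH]; intros [|x v].
    + rule 3 [r; 0]. exact Hr.
    + rule 2 [r; x; encl v]. exact Hr.
    + rule 3 [r; S i]. exact Hr.
    + rule 4 [r; i; x; encl v; nth i v 0]. apply IH.
  - inversion H as [| | |? ? ? ws ? Hw Hf| | |]; subst.
    rule 5 [r; encm f; encml gs; encl v; y; encl ws].
    assert (Hr' : reach mrules (stk (encg (GEv f (encl ws) y)) r) 0) by auto.
    clear - IHg Hw Hr'. revert Hr'.
    change (reach mrules (stk (encg (GEv f (encl ws) y)) r) 0 ->
            reach mrules (stk (encg (GEvs gs (encl v) (encl ws)))
                            (stk (encg (GEv f (encl ws) y)) r)) 0).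
    generalize (stk (encg (GEv f (encl ws) y)) r). intros r' Hr'.
    induction Hw as [|g w gs ws Hg Hw IH].
    + rule 6 [r'; encl v]. exact Hr'.
    + inversion IHg; subst. rule 7 [r'; encm g; encml gs; encl v; w; encl ws].
      apply H1; auto.
  - destruct v as [|n v]; [inversion H|].
    revert y H r Hr. induction n as [|n IHn]; intros y H r Hr; inversion H; subst.
    + rule 8 [r; encm f; encm g; encl v; y]. apply IHf; auto.
    + rule 9 [r; encm f; encm g; n; encl v; y; z]. apply IHn; [assumption|].
      apply (IHg (n :: z :: v)); auto.
  - inversion H as [| | | | | |? ? ? H1 H2]; subst.
    rule 10 [r; encm f; encl v; y]. apply (IHf (y :: v)); [assumption|].
    clear H1 H. induction y as [|y IHy].
    + rule 11 [r; encm f; encl v]. exact Hr.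
    + destruct (H2 y) as [k Hk]; [lia|].
      rule 12 [r; encm f; encl v; y; k]. apply (IHf (y :: v)); [assumption|].
      apply IHy. auto.
Qed.

Lemma reach_ev f v y :
  reach mrules (stk (encg (GEv f (encl v) y)) 0) 0 <-> ev f v y.
Proof.
  split; intro H.
  - apply (reach_sound [GEv f (encl v) y]) in H. inversion H; subst. auto.
  - apply reach_complete; [exact H|apply reach_refl].
Qed.

(** * Closure properties of exponential Diophantine relations *)

Section Diophantine.
Variables (dio : ((nat -> nat) -> Prop) -> Prop) (b : nat).
Hypotheses (b2 : 2 <= b)
  (dio_and : forall P Q, dio P -> dio Q -> dio (fun r => P r /\ Q r))
  (dio_ex : forall P : nat -> (nat -> nat) -> Prop,
     dio (fun r => P (r 0) (fun i => r (S i))) -> dio (fun r => exists n, P n r))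
  (dio_ren : forall P f, dio P -> dio (fun r => P (fun i => r (f i))))
  (dio_ext : forall P Q, (forall r, P r <-> Q r) -> dio Q -> dio P)
  (dio_one : forall x, dio (fun r => r x = 1))
  (dio_plus : forall x y z, dio (fun r => r x + r y = r z))
  (dio_times : forall x y z, dio (fun r => r x * r y = r z))
  (dio_exp : forall x y, dio (fun r => b ^ r x = r y)).

Definition dfun (f : (nat -> nat) -> nat) : Prop :=
  dio (fun r => r 0 = f (fun i => r (S i))).

Lemma dfun_ren f g : dfun f -> dfun (fun r => f (fun i => r (g i))).
Proof. exact (dio_ren (fun r => r 0 = f (fun i => r (S i))) (up g)). Qed.

Lemma dio_subst f (P : nat -> (nat -> nat) -> Prop) :
  dfun f -> dio (fun r => P (r 0) (fun i => r (S i))) -> dio (fun r => P (f r) r).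
Proof.
  intros Hf HP.
  apply dio_ext with (fun r => exists n, n = f r /\ P n r).
  - intro r. split; [eauto|]. now intros [n [-> H]].
  - apply (dio_ex (fun n r => n = f r /\ P n r)). now apply dio_and.
Qed.

Lemma dio_rel2 (Q : nat -> nat -> Prop) : dio (fun r => Q (r 1) (r 0)) ->
  forall f g, dfun f -> dfun g -> dio (fun r => Q (f r) (g r)).
Proof.
  intros H f g Hf Hg.
  apply (dio_subst f (fun n r => Q n (g r)) Hf).
  apply (dio_subst (fun r => g (fun i => r (S i))) (fun m r => Q (r 0) m));
    [now apply dfun_ren|exact H].
Qed.

Lemma dfun_op2 (F : nat -> nat -> nat) : dio (fun r => r 2 = F (r 1) (r 0)) ->
  forall f g, dfun f -> dfun g -> dfun (fun r => F (f r) (g r)).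
Proof.
  intros H f g Hf Hg. unfold dfun.
  apply (dio_subst (fun r => f (fun i => r (S i)))
           (fun n r => r 0 = F n (g (fun i => r (S i))))); [now apply dfun_ren|].
  apply (dio_subst (fun r => g (fun i => r (S (S i)))) (fun m r => r 1 = F (r 0) m));
    [now apply (dfun_ren g (fun i => S (S i)))|exact H].
Qed.

Lemma dfun_op1 (F : nat -> nat) : dio (fun r => r 1 = F (r 0)) ->
  forall f, dfun f -> dfun (fun r => F (f r)).
Proof.
  intros H f Hf. unfold dfun.
  apply (dio_subst (fun r => f (fun i => r (S i))) (fun n r => r 0 = F n));
    [now apply dfun_ren|exact H].
Qed.

Lemma dio_eqvar x y : dio (fun r => r x = r y).
Proof.
  apply dio_ext with (fun r => exists n, n + n = n /\ r x + n = r y).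
  - intro r. split; [exists 0; lia|]. intros [n H]. lia.
  - apply (dio_ex (fun n r => n + n = n /\ r x + n = r y)).
    apply dio_and; [apply (dio_plus 0 0 0)|apply (dio_plus (S x) 0 (S y))].
Qed.

Lemma dfun_var i : dfun (fun r => r i).
Proof. apply (dio_eqvar 0 (S i)). Qed.

Lemma dfun_add f g : dfun f -> dfun g -> dfun (fun r => f r + g r).
Proof.
  apply dfun_op2. apply dio_ext with (fun r => r 1 + r 0 = r 2); [|apply dio_plus].
  intro r. split; auto.
Qed.

Lemma dfun_mul f g : dfun f -> dfun g -> dfun (fun r => f r * g r).
Proof.
  apply dfun_op2. apply dio_ext with (fun r => r 1 * r 0 = r 2); [|apply dio_times].
  intro r. split; auto.
Qed.

Lemma dfun_bpow f : dfun f -> dfun (fun r => b ^ f r).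
Proof.
  apply (dfun_op1 (fun n => b ^ n)).
  apply dio_ext with (fun r => b ^ r 0 = r 1); [|apply dio_exp].
  intro r. split; auto.
Qed.

Lemma dfun_cst c : dfun (fun _ => c).
Proof.
  induction c as [|c IH].
  - apply dio_ext with (fun r => r 0 + r 0 = r 0); [|apply dio_plus]. intro r. lia.
  - apply dio_ext with (fun r => r 0 = (fun _ => c) (fun i : nat => r (S i)) + 1).
    + intro r. lia.
    + apply (dfun_add (fun _ => c) (fun _ => 1)); [exact IH|].
      apply (dio_one 0).
Qed.

Lemma dfun_succ f : dfun f -> dfun (fun r => S (f r)).
Proof.
  intro H. apply dio_ext with (fun r => r 0 = f (fun i => r (S i)) + 1).
  - intro r. lia.
  - apply (dfun_add f (fun _ => 1)); [exact H|apply dfun_cst].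
Qed.

Lemma dio_eq f g : dfun f -> dfun g -> dio (fun r => f r = g r).
Proof. apply (dio_rel2 eq), (dio_eqvar 1 0). Qed.

Lemma dio_le f g : dfun f -> dfun g -> dio (fun r => f r <= g r).
Proof.
  apply (dio_rel2 le).
  apply dio_ext with (fun r => exists n, r 1 + n = r 0).
  - intro r. split; [exists (r 0 - r 1); lia|]. intros [n H]. lia.
  - apply (dio_ex (fun n r => r 1 + n = r 0)), (dio_plus 2 0 1).
Qed.

Lemma dio_lt f g : dfun f -> dfun g -> dio (fun r => f r < g r).
Proof. intros Hf Hg. exact (dio_le _ _ (dfun_succ f Hf) Hg). Qed.

Local Ltac dio_tac :=
  repeat match goal with
  | |- dio (fun r => _ /\ _) => apply dio_and
  | |- dio (fun r => exists n, _) => apply dio_ex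
  | |- dio (fun r => _ = _) => apply dio_eq
  | |- dio (fun r => _ <= _) => apply dio_le
  | |- dio (fun r => _ < _) => apply dio_lt
  | |- dfun (fun r => r _) => apply dfun_var
  | |- dfun (fun r => S _) => apply dfun_succ
  | |- dfun (fun r => _ + _) => apply dfun_add
  | |- dfun (fun r => _ * _) => apply dfun_mul
  | |- dfun (fun r => b ^ _) => apply dfun_bpow
  | |- dfun (fun _ => ?c) => apply dfun_cst
  | H : _ |- _ => apply H
  end.

Lemma dio_divide f g : dfun f -> dfun g -> dio (fun r => Nat.divide (f r) (g r)).
Proof. apply (dio_rel2 Nat.divide). unfold Nat.divide. dio_tac. Qed.

Lemma lt_bpow n : n < b ^ n.
Proof. apply Nat.pow_gt_lin_r. lia. Qed.

(* [b^(my)] is congruent to [x^y] modulo [b^m - x], and [m] makes the modulus large. *)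
Lemma pow_char x y z : let m := x * y + x + 1 in
  z = x ^ y <-> z + x < b ^ m /\ exists n, b ^ (m * y) + n * x = n * b ^ m + z.
Proof.
  intro m.
  assert (big : x ^ y + x < b ^ m).
  { assert (x ^ y <= b ^ (x * y)).
    { rewrite Nat.pow_mul_r. apply Nat.pow_le_mono_l. pose proof (lt_bpow x). lia. }
    unfold m. rewrite !Nat.pow_add_r, Nat.pow_1_r.
    pose proof (lt_bpow x).
    assert (1 <= b ^ (x * y)) by (apply Nat.neq_0_lt_0, Nat.pow_nonzero; lia).
    set (X := b ^ (x * y)) in *. set (Y := b ^ x) in *. clearbody X Y.
    assert (X + Y <= 2 * (X * Y)) by nia. assert (2 * (X * Y) <= X * Y * b) by nia. lia. }
  assert (H : exists n, b ^ (m * y) + n * x = n * b ^ m + x ^ y).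
  { rewrite Nat.pow_mul_r. clear big. set (B := b ^ m).
    assert (HB : x <= B).
    { unfold B. apply Nat.le_trans with m; [unfold m; nia|]. apply Nat.lt_le_incl, lt_bpow. }
    clearbody B. clear m. induction y as [|y [n IH]]; [exists 0; simpl; lia|].
    exists (n * x + B ^ y). rewrite !Nat.pow_succ_r'.
    assert (B * B ^ y = (B - x) * B ^ y + x * B ^ y) by nia. nia. }
  destruct H as [n Hn]. split.
  - intros ->. split; [exact big|]. now exists n.
  - intros [Hz [n' Hn']]. set (B := b ^ m) in *. set (P := b ^ (m * y)) in *.
    (* Both [z] and [x ^ y] are remainders of the same number modulo [B - x]. *)
    assert (E : n * (B - x) + x ^ y = n' * (B - x) + z) by nia.
    assert (n = n') by nia. subst n'. lia.
Qed.

Lemma dfun_pow f g : dfun f -> dfun g -> dfun (fun r => f r ^ g r).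
Proof.
  apply dfun_op2.
  eapply dio_ext; [intro r; apply pow_char|]. cbv zeta. dio_tac.
Qed.

Lemma dfun_binom f g : dfun f -> dfun g -> dfun (fun r => binom (f r) (g r)).
Proof.
  apply dfun_op2.
  eapply dio_ext.
  (* The base of the digits must exceed [2 ^ r 1]; this power of [b] does, and it is definable. *)
  - intro r. apply (binom_char (b ^ S (r 1))).
    apply Nat.le_lt_trans with (b ^ r 1); [now apply Nat.pow_le_mono_l|].
    apply Nat.pow_lt_mono_r; lia.
  - pose proof dfun_pow. dio_tac.
Qed.

Lemma dfun_factl f : dfun f -> dfun (fun r => factl (f r)).
Proof.
  apply dfun_op1.
  eapply dio_ext.
  - intro r. apply (factl_char (S (S (r 0 ^ r 0) * (r 0 * r 0)))). lia.
  - pose proof dfun_pow. pose proof dfun_binom. dio_tac.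
Qed.

Lemma dfun_eval e f : dfun (fun r => eval e (fun i => r (f i))).
Proof. apply (dfun_ren (eval e)). clear f. induction e; simpl; dio_tac. Qed.

Lemma dio_forall_lt n (P : nat -> (nat -> nat) -> Prop) :
  (forall i, i < n -> dio (P i)) -> dio (fun r => forall i, i < n -> P i r).
Proof.
  induction n as [|n IH]; intro H.
  - apply dio_ext with (fun r => 0 = 0); [intro r; split; [reflexivity|lia]|dio_tac].
  - apply dio_ext with (fun r => (forall i, i < n -> P i r) /\ P n r).
    + intro r. split; [auto|]. intros [H1 H2] i Hi.
      destruct (Nat.eq_dec i n) as [->|]; [exact H2|apply H1; lia].
    + apply dio_and; [apply IH|apply H]; auto.
Qed.

Lemma dio_exn m (P : (nat -> nat) -> Prop) :
  dio P -> dio (fun r => exists a, P (env_app m a r)).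
Proof.
  intro HP. induction m as [|m IH].
  - apply dio_ext with P; [|exact HP]. intro r.
    assert (E : forall a, env_app 0 a r = r).
    { intro a. extensionality i. apply (env_app_ge 0). }
    split; [intros [a H]; now rewrite E in H|intro H; exists r; now rewrite E].
  - apply dio_ext with (fun r => exists n a, P (env_app m a (scons n r))).
    + intro r. split.
      * intros [a H]. exists (a m), a. now rewrite env_app_S in H.
      * intros [n [a H]]. set (a' := fun i => if Nat.ltb i m then a i else n).
        exists a'. rewrite env_app_S.
        replace (env_app m a' (scons (a' m) r)) with (env_app m a (scons n r));
          [exact H|].
        extensionality i. unfold a'. rewrite Nat.ltb_irrefl. unfold env_app.
        now destruct (Nat.ltb i m).
    + apply (dio_ex (fun n r => exists a, P (env_app m a (scons n r)))).
      eapply dio_ext; [|exact IH]. intro r. cbv beta.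
      replace (scons (r 0) (fun i => r (S i))) with r; [reflexivity|].
      extensionality i. now destruct i.
Qed.

(** [bounded_forall] leaves existential quantifiers, a conjunction of the fixed length [m] and
    functions already known to be definable. *)
Lemma dio_bounded_forall (l r : expr) m : dio (fun rho => forall k, k < rho 0 -> exists w,
  eval l (env_app m w (scons k (fun i => rho (S i)))) =
  eval r (env_app m w (scons k (fun i => rho (S i))))).
Proof.
  eapply dio_ext; [intro rho; apply bounded_forall|].
  (* [body] reads its variables in the order witnesses, [N], [Q], [u], bound, parameters. [g1] puts
     [u] in place of the witnesses and keeps the bound; [g2] keeps the witnesses and puts [N] in
     place of the bound by skipping [Q], [u] and the bound. *)
  set (g1 := fun i => if Nat.ltb i m then m + 2 else i + 3).
  set (g2 := fun i => if Nat.leb i m then i else i + 3).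
  set (body := fun e : nat -> nat =>
    2 < e (m + 1) /\ e (m + 3) <= e (m + 1) /\ e (m + 2) < e (m + 1) /\
    eval l (fun i => e (g1 i)) < e (m + 1) /\ eval r (fun i => e (g1 i)) < e (m + 1) /\
    Nat.divide (factl (e (m + 1)) * factl (e (m + 1))) (S (e (m + 0))) /\
    (forall i, i < m ->
       Nat.divide (binom (e (m + 0)) (e (m + 3))) (binom (e i) (S (e (m + 2))))) /\
    exists s t, eval l (fun i => e (g2 i)) + s * binom (e (m + 0)) (e (m + 3)) =
                eval r (fun i => e (g2 i)) + t * binom (e (m + 0)) (e (m + 3))).
  apply dio_ext with
    (fun rho => exists u Q N, exists a, body (env_app m a (scons N (scons Q (scons u rho))))).
  - intro rho.
    assert (E1 : forall u Q N a,
      (fun i => env_app m a (scons N (scons Q (scons u rho))) (g1 i)) =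
      env_app m (fun _ => u) (scons (rho 0) (fun i => rho (S i)))).
    { intros u Q N a. extensionality i. unfold g1. destruct (Nat.ltb_spec i m).
      - now rewrite env_app_ge, env_app_lt.
      - replace i with (m + (i - m)) by lia. generalize (i - m). intro j.
        rewrite <- Nat.add_assoc, !env_app_ge, Nat.add_comm. simpl. now destruct j. }
    assert (E2 : forall u Q N a,
      (fun i => env_app m a (scons N (scons Q (scons u rho))) (g2 i)) =
      env_app m a (scons N (fun i => rho (S i)))).
    { intros u Q N a. extensionality i. unfold g2. destruct (Nat.leb_spec i m).
      - destruct (Nat.eq_dec i m) as [->|]; [|now rewrite !env_app_lt by lia].
        replace m with (m + 0) at 2 4 by lia. now rewrite !env_app_ge.
      - replace i with (m + S (i - S m)) by lia. generalize (i - S m). intro j.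
        rewrite <- Nat.add_assoc, !env_app_ge, Nat.add_comm. reflexivity. }
    unfold body.
    split; intros [u [Q [N [a H]]]]; exists u, Q, N, a; revert H;
      rewrite !E1, !E2, !env_app_ge; simpl scons;
      intros [h1 [h2 [h3 [h4 [h5 [h6 [h7 h8]]]]]]]; repeat (split; [assumption|]);
      (split; [|exact h8]); intros i Hi; specialize (h7 i Hi);
      rewrite env_app_lt in *; assumption.
  - apply (dio_ex (fun u rho => exists Q N, exists a,
      body (env_app m a (scons N (scons Q (scons u rho)))))).
    apply (dio_ex (fun Q rho => exists N, exists a,
      body (env_app m a (scons N (scons Q (scons (rho 0) (fun i => rho (S i)))))))).
    apply (dio_ex (fun N rho => exists a,
      body (env_app m a (scons N (scons (rho 0) (scons (rho 1) (fun i => rho (S (S i))))))))).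
    apply dio_ext with (fun rho => exists a, body (env_app m a rho)).
    + intro rho. cbv beta.
      replace (scons (rho 0) (scons (rho 1) (scons (rho 2) (fun i => rho (S (S (S i)))))))
        with rho; [reflexivity|].
      extensionality i. now destruct i as [|[|[|i]]].
    + apply dio_exn. unfold body.
      pose proof dfun_binom. pose proof dfun_factl. pose proof dfun_eval.
      pose proof dio_divide.
      dio_tac. apply (dio_forall_lt m (fun i e => Nat.divide (binom (e (m + 0)) (e (m + 3)))
        (binom (e i) (S (e (m + 2)))))). intros. dio_tac.
Qed.

Lemma dio_beta f g h k : dfun f -> dfun g -> dfun h -> dfun k ->
  dio (fun r => beta (f r) (g r) (h r) (k r)).
Proof.
  intros Hf Hg Hh Hk. unfold beta.
  apply dio_ex.
  apply (dfun_ren f S) in Hf. apply (dfun_ren g S) in Hg.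
  apply (dfun_ren h S) in Hh. apply (dfun_ren k S) in Hk. dio_tac.
Qed.

(** A path of [T] steps is coded by two numbers through the beta function, and [kernel] makes the
    condition on its steps a bounded quantifier over one polynomial equation. *)
Lemma dio_reach v rules f g :
  (forall lr, In lr rules -> evars_lt v (fst lr) /\ evars_lt v (snd lr)) ->
  dfun f -> dfun g -> dio (fun r => reach rules (f r) (g r)).
Proof.
  intros Hv Hf Hg.
  apply dio_ext with (fun r => exists T C D, beta C D 0 (f r) /\ beta C D T (g r) /\
    forall k, k < T -> exists w,
      eval (fst (kernel v rules)) (env_app (6 + v) w (scons k (scons C (scons D r)))) =
      eval (snd (kernel v rules)) (env_app (6 + v) w (scons k (scons C (scons D r))))).
  - intro r. split.
    + intros [T [x [H0 [HT H]]]]. destruct (godel_beta (S T) x) as [C [D HCD]].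
      exists T, C, D. rewrite <- H0, <- HT.
      split; [apply (HCD 0); lia|]. split; [apply (HCD T); lia|].
      intros k Hk. apply kernel_spec; [exact Hv|].
      exists (x k), (x (S k)).
      split; [apply (HCD k); lia|]. split; [apply (HCD (S k)); lia|auto].
    (* Any [C] and [D] decode to the sequence of remainders. *)
    + intros [T [C [D [H0 [HT H]]]]]. exists T, (fun k => C mod (1 + (k + 1) * D)).
      assert (E : forall k, beta C D k (C mod (1 + (k + 1) * D))).
      { intro k. exists (C / (1 + (k + 1) * D)).
        pose proof (Nat.div_mod_eq C (1 + (k + 1) * D)).
        pose proof (Nat.mod_upper_bound C (1 + (k + 1) * D)). lia. }
      split; [exact (beta_inj _ _ _ _ _ (E 0) H0)|].
      split; [exact (beta_inj _ _ _ _ _ (E T) HT)|].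
      intros k Hk. apply H in Hk. apply kernel_spec in Hk; [|exact Hv].
      destruct Hk as [x [y [Hx [Hy Hs]]]].
      rewrite (beta_inj _ _ _ _ _ (E k) Hx), (beta_inj _ _ _ _ _ (E (S k)) Hy). exact Hs.
  - do 3 apply dio_ex.
    apply (dfun_ren f (fun i => S (S (S i)))) in Hf.
    apply (dfun_ren g (fun i => S (S (S i)))) in Hg.
    apply dio_and; [|apply dio_and].
    + apply dio_beta; dio_tac.
    + apply dio_beta; dio_tac.
    (* The three quantifiers leave [D], [C], [T] as variables 0, 1, 2, while the bound [T] has to
       come first and [C] before [D]. *)
    + pose proof (dio_ren _ (fun i => match i with 0 => 2 | 1 => 1 | 2 => 0 | i => i end)
        (dio_bounded_forall (fst (kernel v rules)) (snd (kernel v rules)) (6 + v))) as H.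
      eapply dio_ext; [|exact H]. intro r. cbv beta.
      assert (E : forall k, scons k (scons (r 1) (scons (r 0) (fun i => r (S (S (S i)))))) =
        scons k (fun i => r (match S i with 0 => 2 | 1 => 1 | 2 => 0 | S i => S i end))).
      { intro k. extensionality i. now destruct i as [|[|[|i]]]. }
      split; intros HH k Hk; destruct (HH k Hk) as [w Hw]; exists w;
        [rewrite <- E|rewrite E]; exact Hw.
Qed.

Lemma dio_ev f y : dio (fun r => ev f [r 0] y).
Proof.
  eapply dio_ext; [intro r; symmetry; apply reach_ev|].
  apply (dio_reach 7); [exact mrules_vars| |apply dfun_cst].
  unfold stk, encg, encl, sqpair. dio_tac.
Qed.
End Diophantine.

(** * Diagonalization *)

Lemma triangle_double n : 2 * (n * (n + 1) / 2) = n * (n + 1).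
Proof.
  assert (exists k, n * (n + 1) = k * 2) as [k ->].
  { induction n as [|n [k IH]]; [exists 0; reflexivity|exists (k + n + 1); nia]. }
  rewrite Nat.div_mul; lia.
Qed.

Lemma cpair_inj x y x' y' : cpair x y = cpair x' y' -> x = x' /\ y = y'.
Proof.
  unfold cpair. intro H.
  pose proof (triangle_double (x + y)). pose proof (triangle_double (x' + y')).
  assert (E : (x + y) * (x + y + 1) + 2 * y = (x' + y') * (x' + y' + 1) + 2 * y') by lia.
  assert (x + y = x' + y') by nia. assert (y = y') by nia. lia.
Qed.

Lemma enc_list_inj {A} (e : A -> nat) : (forall x y, e x = e y -> x = y) ->
  forall l l', enc_list e l = enc_list e l' -> l = l'.
Proof.
  intro He. induction l as [|x l IH]; intros [|x' l'] H; try discriminate H; [reflexivity|].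
  simpl in H. injection H as H. apply cpair_inj in H as [H1 H2]. f_equal; auto.
Qed.

Lemma enc_letter_inj l l' : enc_letter l = enc_letter l' -> l = l'.
Proof.
  destruct l as [x c], l' as [x' c']. unfold enc_letter. cbn [fst snd]. intro H.
  assert (enc_sym x = enc_sym x' /\ c = c') as [E ->] by (destruct c, c'; split; lia || auto).
  f_equal. destruct x as [[]|n], x' as [[]|n']; simpl in E; try lia; try reflexivity.
  f_equal. lia.
Qed.

Lemma enc_system_inj S S' : enc_system S = enc_system S' -> S = S'.
Proof. apply enc_list_inj, enc_list_inj, enc_letter_inj. Qed.

(** * Codes of systems computed by recursive functions *)

Fixpoint mcst (c : nat) : mu :=
  match c with 0 => MZero | S c => MComp MSucc [mcst c] end.

Lemma ev_comp1 f g v x y : ev g v x -> ev f [x] y -> ev (MComp f [g]) v y.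
Proof. intros. econstructor; eauto. Qed.

Lemma ev_comp2 f g h v x y z :
  ev g v x -> ev h v y -> ev f [x; y] z -> ev (MComp f [g; h]) v z.
Proof. intros. econstructor; eauto. Qed.

Lemma ev_cst c v : ev (mcst c) v c.
Proof. induction c; simpl; [constructor|]. eapply ev_comp1; [exact IHc|constructor]. Qed.

Definition madd : mu := MPrec (MProj 0) (MComp MSucc [MProj 1]).

Lemma ev_madd x y : ev madd [x; y] (x + y).
Proof.
  induction x as [|x IH].
  - apply ev_prec0, (ev_proj 0 [y]).
  - eapply ev_precS; [exact IH|].
    eapply ev_comp1; [apply ev_proj|apply (ev_succ (x + y))].
Qed.

Definition mtri : mu := MPrec MZero (MComp madd [MProj 1; MComp MSucc [MProj 0]]).

Lemma ev_mtri n : ev mtri [n] (n * (n + 1) / 2).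
Proof.
  induction n as [|n IH].
  - apply ev_prec0, ev_zero.
  - replace (S n * (S n + 1) / 2) with (n * (n + 1) / 2 + S n).
    + eapply ev_precS; [exact IH|].
      eapply ev_comp2; [apply (ev_proj 1)| |apply ev_madd].
      eapply ev_comp1; [apply (ev_proj 0)|apply ev_succ].
    + pose proof (triangle_double n). pose proof (triangle_double (S n)). lia.
Qed.

Definition mcons : mu := MComp MSucc [MComp madd [MComp mtri [madd]; MProj 1]].

Lemma ev_mcons x y : ev mcons [x; y] (S (cpair x y)).
Proof.
  eapply ev_comp1; [|apply ev_succ].
  eapply ev_comp2; [|apply (ev_proj 1)|apply ev_madd].
  eapply ev_comp1; [apply ev_madd|apply ev_mtri].
Qed.

(** Forces unknown 0 to be the canonical representative of [n]. *)
Definition input_eqn (n : nat) : equation :=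
  wpow [(Const Gs, false); (Const Gt, false)] n ++ [(Var 0, true)].

(** The constants 2 and 4 are the codes of the letters [s] and [t]; each recursion step puts one
    more [s t] in front. *)
Definition minput : mu :=
  MPrec (mcst (enc_list enc_letter (input_eqn 0)))
    (MComp mcons [mcst 2; MComp mcons [mcst 4; MProj 1]]).

Lemma ev_minput n : ev minput [n] (enc_list enc_letter (input_eqn n)).
Proof.
  induction n as [|n IH].
  - apply ev_prec0, ev_cst.
  - eapply ev_precS; [exact IH|].
    eapply ev_comp2; [apply ev_cst| |apply ev_mcons].
    eapply ev_comp2; [apply ev_cst|apply (ev_proj 1)|apply ev_mcons].
Qed.

(** The diagonal function: a system is fed its own code. *)
Definition mdiag : mu := MComp mcons [minput; MProj 0].

Lemma ev_mdiag T :
  ev mdiag [enc_system T] (enc_system (input_eqn (enc_system T) :: T)).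
Proof.
  eapply ev_comp2; [apply ev_minput|apply (ev_proj 0)|apply ev_mcons].
Qed.

Lemma subst_wpow sigma w n : subst sigma (wpow w n) = wpow (subst sigma w) n.
Proof. induction n; simpl; [reflexivity|]. now rewrite subst_app, IHn. Qed.

Lemma dio_system p q (hp : prime p) (hq : prime q) (P : nat -> Prop) :
  dio p q (fun r => P (r 0)) ->
  exists T, forall n, has_solution (bs_relators p q) (input_eqn n :: T) <-> P n.
Proof.
  (* All free variables of [F] are merged into unknown 0, and the bound ones are numbered from 1. *)
  intros [F [F1 F2]]. exists (fst (prenex F (fun _ => 0) 1)). intro n.
  assert (E : forall sigma, subst sigma (input_eqn n) =
    wpow [(Gs, false); (Gt, false)] n ++ winv (sigma 0)).
  { intro sigma. unfold input_eqn. rewrite subst_app, subst_wpow. f_equal. apply app_nil_r. }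
  split.
  - intros [sigma H]. inversion H as [|? ? H1 H2]; subst.
    rewrite E in H1. apply (proj1 (geq_eqn _ _ _)) in H1.
    apply prenex_sound in H2.
    apply (F1 _ (fun _ => n)) in H2; [exact H2|].
    (* Unknown 0 is some word equal to [(s t)^n] in the group, hence a representative of [n], which
       is all that soundness of [F] asks for. *)
    intros _. apply (rword_geq p q hp hq) in H1.
    pose proof (repz_st p q hp hq n) as [h1 h2].
    unfold repz, es, et in *. now rewrite <- H1.
  - intro HP. apply (F2 (fun _ => n)) in HP.
    destruct (prenex_complete _ F (fun _ => 0) 1
      (fun _ => wpow [(Gs, false); (Gt, false)] n) (fun _ => Nat.lt_0_1) HP) as [sigma [A H]].
    exists sigma. constructor; [|exact H].
    rewrite E, (A 0) by lia. apply geq_mulV.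
Qed.

Theorem theorem3p4 (p q : Z) (hp : prime p) (hq : prime q) (hpq : p <> q) :
  ~ diophantine_decidable (bs_relators p q).
Proof.
  intros [f Hf].
  (* On the code of [T] the composite returns the verdict of [f] on [T] fed with its own code; the
     definable relation is that this verdict is 0. *)
  assert (HD : dio p q (fun r => ev (MComp f [mdiag]) [r 0] 0)).
  { apply (dio_ev (dio p q) (base p q)).
    - apply base_ge2; assumption.
    - apply dio_and.
    - apply dio_ex; assumption.
    - apply dio_ren.
    - apply dio_ext.
    - apply dio_one; assumption.
    - apply dio_plus; assumption.
    - apply dio_times; assumption.
    - apply dio_exp; assumption. }
  apply (dio_system p q hp hq (fun n => ev (MComp f [mdiag]) [n] 0)) in HD as [T HT].
  specialize (HT (enc_system T)).
  set (S := input_eqn (enc_system T) :: T) in *.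
  assert (Hev : forall y, ev (MComp f [mdiag]) [enc_system T] y <-> ev f [enc_system S] y).
  { intro y. split; intro H.
    - inversion H as [| | |? ? ? ws ? Hw Hy| | |]; subst.
      inversion Hw as [|? w ? ? H1 H2]; subst. inversion H2; subst.
      now rewrite (ev_det _ _ _ _ H1 (ev_mdiag T)) in Hy.
    - eapply ev_comp1; [apply ev_mdiag|exact H]. }
  rewrite Hev in HT. destruct (Hf (enc_system S)) as [H1 H0].
  (* A solution makes [f] answer both 1, by correctness, and 0, by the choice of [T]. So there is
     none; [f] then answers 0, and a solution exists after all. *)
  assert (N : ~ has_solution (bs_relators p q) S).
  { intro H. assert (E : ev f [enc_system S] 1) by (apply H1; eauto).
    discriminate (ev_det _ _ _ _ E (proj1 HT H)). }
  apply N, HT, H0. intros [S' [E H]]. apply enc_system_inj in E as ->. exact (N H).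
Qed.
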